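(* Let $A$ be a natural, unital Banach function algebra, with character space $\Phi_A$, and let $x\in\Phi_A$. Then: (i) the hull of $J_x$, i.e. the set $\{y\in\Phi_A: J_x\subseteq M_y\}$, is connected in the Gelfand topology; (ii) the set $\{y\in\Phi_A: x\sim y\}$ is connected in the Gelfand topology.
   Context: A unital Banach function algebra on a compact Hausdorff space $X$ is a subalgebra $A$ of $C(X)$ (continuous complex-valued functions on $X$) which contains the constants, separates the points of $X$, and is a Banach algebra under some norm. Its character space $\Phi_A$ carries the (compact Hausdorff) Gelfand topology, and $X$ is identified with a subset of $\Phi_A$ via point evaluations. $A$ is natural if it is regarded as an algebra of functions on $X=\Phi_A$ (every character is evaluation at a point of $X$). For $x\in\Phi_A$: $M_x=\{f\in A: f(x)=0\}$, and $J_x$ is the ideal of those $f\in A$ vanishing on some Gelfand neighbourhood of $x$. The hull-kernel topology on $\Phi_A$ is the topology whose open sets are the sets $\{y\in\Phi_A: I\not\subseteq M_y\}$ for closed ideals $I$ of $A$ (equivalently, the sets $\{y: f(y)\neq 0\}$, $f\in A$, form a base). Write $x\sim y$ if $x$ and $y$ cannot be separated by disjoint hull-kernel open subsets of $\Phi_A$ (so $x\sim x$). *)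

(* Defs.v *)
From HB Require Import structures.
From mathcomp Require Import all_boot all_order all_algebra complex.
From mathcomp Require Import all_classical all_reals all_analysis.

Set Implicit Arguments.
Unset Strict Implicit.
Unset Printing Implicit Defensive.

Import Order.TTheory GRing.Theory Num.Theory.
Import numFieldNormedType.Exports.

Local Open Scope ring_scope.
Local Open Scope classical_set_scope.

(* The regular alias [_^o] is what carries the usual topology of the complex
   plane in MathComp-Analysis; it is convertible to [R[i]]. *)
Notation Cplx R := (R[i]^o)%type.

Record functionAlgebra (R : realType) (X : topologicalType) := FunctionAlgebra {
  fa_set :> set (X -> Cplx R);
  fa_cst : forall a : Cplx R, fa_set (cst a);
  fa_lin : forall (a : R[i]) (f g : X -> Cplx R),
    fa_set f -> fa_set g -> fa_set (a *: f + g);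
  fa_mul : forall f g : X -> Cplx R, fa_set f -> fa_set g -> fa_set (f * g);
  fa_continuous : forall f : X -> Cplx R, fa_set f -> continuous f;
  fa_separates : forall x y : X, x <> y -> exists2 f, fa_set f & f x <> f y }.

Section elements.
Context {R : realType} {X : topologicalType} (A : functionAlgebra R X).

Definition fa_pred : {pred X -> Cplx R} := fun f => f \in fa_set A.

Definition elt : Type := {f : X -> Cplx R | f \in fa_pred}.

Definition elt_fun (f : elt) : X -> Cplx R := val f.

HB.instance Definition _ := [isSub of elt for @sval _ _].
HB.instance Definition _ := [Choice of elt by <:].

Fact fa_subringr_closed : subring_closed fa_pred.
Proof.
split=> [|f g /set_mem fA /set_mem gA|f g /set_mem fA /set_mem gA].
- by apply/mem_set; exact: (fa_cst A 1).
- by apply/mem_set; rewrite addrC -scaleN1r; exact: fa_lin.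
- by apply/mem_set; exact: fa_mul.
Qed.

Fact fa_scaler_closed : GRing.scaler_closed fa_pred.
Proof.
move=> a f /set_mem fA; apply/mem_set; rewrite -[a *: f]addr0.
by apply: fa_lin => //; exact: (fa_cst A 0).
Qed.

HB.instance Definition _ :=
  GRing.isSubringClosed.Build (X -> Cplx R) fa_pred fa_subringr_closed.
HB.instance Definition _ :=
  GRing.isScaleClosed.Build R[i] (X -> Cplx R) fa_pred fa_scaler_closed.
HB.instance Definition _ :=
  GRing.SubChoice_isSubComPzRing.Build _ _ elt (GRing.subringClosedP _).
HB.instance Definition _ := [SubZmodule_isSubLmodule of elt by <:].

End elements.

Coercion elt_fun : elt >-> Funclass.

Section banach.
Context {R : realType} {X : topologicalType} (A : functionAlgebra R X).
Implicit Types (N : elt A -> R) (f g : elt A) (I : set (elt A)).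

(* On [R[i]] the norm [`|a|] is itself an element of [R[i]]; its real part is the
   usual modulus. *)
Record is_banach_algebra_norm N : Prop := {
  norm_eq0 : forall f, N f = 0 -> f = 0;
  norm_add : forall f g, N (f + g) <= N f + N g;
  norm_scale : forall (a : R[i]) f, N (a *: f) = complex.Re `|a| * N f;
  norm_mul : forall f g, N (f * g) <= N f * N g;
  norm_complete : forall u : nat -> elt A,
    (forall e : R, 0 < e -> exists n, forall i j,
       (n <= i)%N -> (n <= j)%N -> N (u i - u j) < e) ->
    exists f, (fun n => N (u n - f)) @ \oo --> (0 : R) }.

Record is_closed_ideal N I : Prop := {
  ideal0 : I 0;
  idealD : forall f g, I f -> I g -> I (f + g);
  idealM : forall f g, I g -> I (f * g);
  ideal_closed : forall f,
    (forall e : R, 0 < e -> exists2 g, I g & N (f - g) < e) -> I f }.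

Record is_character (phi : elt A -> Cplx R) : Prop := {
  character_neq0 : exists f, phi f <> 0;
  character_lin : forall (a : R[i]) f g, phi (a *: f + g) = a * phi f + phi g;
  character_mul : forall f g, phi (f * g) = phi f * phi g }.

(* As a subtype of a space of functions with the topology of pointwise
   convergence, this carries exactly the Gelfand topology. *)
Definition charSpace : topologicalType :=
  set_type [set phi : {ptws elt A -> Cplx R} | is_character phi].

Definition gelfand f (phi : charSpace) : Cplx R := val phi f.

(* [X] being compact Hausdorff and [A] separating its points, the evaluation map
   from [X] to [charSpace] is then a homeomorphism. *)
Definition natural :=
  forall phi : charSpace, exists x : X, forall f, gelfand f phi = f x.

Definition Mideal (x : charSpace) : set (elt A) := [set f | gelfand f x = 0].

Definition Jideal (x : charSpace) : set (elt A) :=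
  [set f | \forall y \near x, gelfand f y = 0].

Definition hull I : set charSpace := [set y | I `<=` Mideal y].

Definition hk_open N (U : set charSpace) :=
  exists2 I, is_closed_ideal N I & U = [set y | ~ (I `<=` Mideal y)].

Definition hk_inseparable N (x y : charSpace) :=
  ~ exists U V : set charSpace,
      [/\ hk_open N U, hk_open N V, U x, V y & U `&` V = set0].

End banach.

(* Main.v *)
(** The Shilov idempotent theorem drives both parts.  For a set [U] let [I(U)] be
    the ideal of functions vanishing on [U].  In (i) [U] runs over the
    neighbourhoods of [x], in (ii) over the cozero sets containing [x] (two points
    are inseparable iff no product [f g = 0] has [f x] and [g y] nonzero); the set
    to be shown connected is the intersection of the hulls of the [I(U)].  If it
    splits as [E] and [F] with [x] in [E], then by compactness the hull of some
    [I(U)] splits accordingly, and Shilov gives [e] in the algebra equal to [0] on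
    the part around [E] and to [1] on the part around [F].  So [e] is idempotent
    on [U], which therefore can be shrunk to the points of [U] where [e = 0]; hence
    [e] vanishes on the intersection, and [F] is empty.

    Shilov's theorem is proved with one variable at a time and without analytic
    functional calculus.  For a submultiplicative seminorm [q] let [sp q] be the
    set of points whose evaluations are dominated by [q].  Finitely many units [g]
    with [|g x| < 1 < |g y|] separate [E] from [F]; cutting [sp q] along
    [|g| = 1] for each of them leaves pieces inside [E] or inside [F], where [0] or
    [1] will do.  Approximate idempotents [a] on [|g| <= 1] and [b] on [|g| >= 1]
    are glued by a Cousin decomposition: for the largest seminorm below [q] in
    which [g] and its inverse are contractions, the Newton iterates
    [x |-> 3 x^2 - 2 x^3] of [a] and [b] become close, so that their difference is
    a Laurent polynomial in [g] with small coefficients, and its two halves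
    correct [a] and [b].

    The spectral radius formula needed here comes from Zorn's lemma: a minimal
    submultiplicative seminorm [s] with [s (h^n) >= rho^n] for all [n] is
    multiplicative, hence the absolute value of a character. *)
From HB Require Import structures.
From mathcomp Require Import all_boot all_order all_algebra complex ring lra.
From mathcomp Require Import all_classical all_reals all_analysis.
Require Import Defs.
Set Implicit Arguments.
Unset Strict Implicit.
Unset Printing Implicit Defensive.
Import Order.TTheory GRing.Theory Num.Theory.
Import numFieldNormedType.Exports.
Local Open Scope ring_scope.
Local Open Scope classical_set_scope.
Import Normc.

(** * Submultiplicative seminorms *)

Section inf_lemmas.
Variable R : realType.
Implicit Types (E F : set R) (x k e f : R).

Lemma le_inf_mulr E x k : E !=set0 -> 0 <= k ->
  (forall e : R, E e -> x <= e * k) -> x <= inf E * k.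
Proof.
move=> [e0 E0] k0 xE; have [k00|kn0] := eqVneq k 0.
  by have := xE _ E0; rewrite k00 !mulr0.
have kp : 0 < k by rewrite lt_neqAle eq_sym kn0.
rewrite -ler_pdivrMr //; apply: lb_le_inf; first by exists e0.
by move=> e Ee; rewrite ler_pdivrMr //; exact: xE.
Qed.

Lemma le_inf_mul E F x : E !=set0 -> F !=set0 ->
  (forall e : R, E e -> 0 <= e) -> (forall f : R, F f -> 0 <= f) ->
  (forall e f : R, E e -> F f -> x <= e * f) -> x <= inf E * inf F.
Proof.
move=> E0 F0 Ege Fge xEF; rewrite mulrC; apply: le_inf_mulr => //.
  by apply: lb_le_inf.
by move=> f Ff; rewrite mulrC; apply: le_inf_mulr => //; [exact: Fge|move=> e Ee; exact: xEF].
Qed.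

Lemma le_inf_add E F x : E !=set0 -> F !=set0 ->
  (forall e f : R, E e -> F f -> x <= e + f) -> x <= inf E + inf F.
Proof.
move=> E0 F0 xEF; rewrite -lerBlDl; apply: lb_le_inf => // f Ff.
rewrite lerBlDl -lerBlDr; apply: lb_le_inf => // e Ee.
by rewrite lerBlDr; exact: xEF.
Qed.

Lemma le_inf_elt E x : (forall e : R, E e -> 0 <= e) -> E x -> inf E <= x.
Proof. by move=> Ege Ex; apply: ge_inf => //; exists 0 => e /Ege. Qed.

End inf_lemmas.

Section normc_lemmas.
Variable R : realType.
Implicit Types z w : R[i].

Lemma normc_ge0 z : 0 <= normc z.
Proof. by case: z => a b; exact: sqrtr_ge0. Qed.

Lemma normcD z w : normc (z + w) <= normc z + normc w.
Proof. exact: le_normcD. Qed.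

Lemma normcN z : normc (- z) = normc z.
Proof. exact: complex.normcN. Qed.

Lemma normcB z w : normc z - normc w <= normc (z - w).
Proof. by rewrite lerBlDr; have := normcD (z - w) w; rewrite subrK. Qed.

Lemma normc_real (x : R) : normc x%:C%C = `|x|.
Proof. by rewrite /= expr0n /= addr0 sqrtr_sqr. Qed.

Lemma normc_nat n : normc (n%:R : R[i]) = n%:R.
Proof. by rewrite -[n%:R](rmorph_nat (real_complex R)) normc_real ger0_norm. Qed.

Lemma normcX z n : normc (z ^+ n) = normc z ^+ n.
Proof. by elim: n => [|n IH]; rewrite ?normc1 // !exprS normcM IH. Qed.

End normc_lemmas.

Section seminorms.
Variables (R : realType) (B : comPzRingType) (c : {rmorphism R[i] -> B}).
Implicit Types (q s : B -> R) (f g h : B) (G : set B).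

Record submult_seminorm q : Prop := SubmultSeminorm {
  sn_ge0 : forall f, 0 <= q f;
  snD : forall f g, q (f + g) <= q f + q g;
  snZ : forall a f, q (c a * f) <= normc a * q f;
  snM : forall f g, q (f * g) <= q f * q g;
  sn1 : q 1 <= 1 }.

Section basics.
Variables (q : B -> R) (sq : submult_seminorm q).

Lemma sn0 : q 0 = 0.
Proof.
apply/eqP; rewrite eq_le sn_ge0 // andbT.
by have := snZ sq 0 1; rewrite rmorph0 mul0r normc0 mul0r.
Qed.

Lemma snN f : q (- f) = q f.
Proof.
suff H g : q (- g) <= q g by apply/le_anti; rewrite H -{1}[f]opprK H.
by have := snZ sq (- 1) g; rewrite rmorphN1 mulN1r normcN normc1 mul1r.
Qed.

Lemma snB f g : q (f - g) <= q f + q g.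
Proof. by rewrite -(snN g); exact: snD. Qed.

Lemma snC a : q (c a) <= normc a.
Proof.
rewrite -[c a]mulr1; apply: le_trans (snZ sq _ _) _.
by rewrite ler_piMr ?normc_ge0 // sn1.
Qed.

Lemma sn_nat n : q n%:R <= n%:R.
Proof.
elim: n => [|n IH]; first by rewrite sn0.
rewrite -addn1 !natrD; apply: le_trans (snD sq _ _) _.
by apply: lerD => //; exact: sn1.
Qed.

Lemma snX f n : q (f ^+ n) <= q f ^+ n.
Proof.
elim: n => [|n IH]; first exact: sn1.
rewrite !exprS; apply: le_trans (snM sq _ _) _.
by apply: ler_wpM2l => //; exact: sn_ge0.
Qed.

(** Euclidean division by [m]: the blocks [f ^+ m] contribute powers of [rho], and the constant adds
    up the finitely many remainders. *)
Lemma power_bounded f (rho : R) (m : nat) : 0 < rho -> (0 < m)%N ->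
  q (f ^+ m) <= rho ^+ m -> exists2 C : R, 0 <= C & forall n, q (f ^+ n) <= C * rho ^+ n.
Proof.
move=> rho0 m0 fm; exists (\sum_(r < m) q (f ^+ r) / rho ^+ r).
  by apply: sumr_ge0 => r _; rewrite divr_ge0 ?sn_ge0 // exprn_ge0 // ltW.
move=> n; rewrite {1}(divn_eq n m) exprD mulnC exprM.
apply: le_trans (snM sq _ _) _.
apply: (@le_trans _ _ (rho ^+ (m * (n %/ m)) * q (f ^+ (n %% m)))).
  apply: ler_wpM2r; first exact: sn_ge0.
  apply: le_trans (snX _ _) _; rewrite exprM lerXn2r //.
    by rewrite nnegrE sn_ge0.
  by rewrite nnegrE exprn_ge0 // ltW.
rewrite (bigD1 (Ordinal (ltn_pmod n m0))) //= mulrDl -[leLHS]addr0 lerD //.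
  have -> : rho ^+ n = rho ^+ (n %% m) * rho ^+ (m * (n %/ m)).
    by rewrite -exprD mulnC addnC -divn_eq.
  by rewrite mulrA divfK 1?mulrC // expf_neq0 // gt_eqF.
rewrite mulr_ge0 ?exprn_ge0 ?(ltW rho0) //; apply: sumr_ge0 => r _.
by rewrite divr_ge0 ?sn_ge0 // exprn_ge0 // ltW.
Qed.

End basics.

(* [adj q G] is the largest submultiplicative seminorm below [q] for which the
   elements of [G] are contractions. *)
Inductive adj_rep q G : B -> R -> Prop :=
| adj_rep0 : adj_rep q G 0 0
| adj_repS a g f t : G g -> adj_rep q G f t -> adj_rep q G (a * g + f) (q a + t).

Definition adj q G f := inf [set t | adj_rep q G f t].

Definition monoid_set G := G 1 /\ forall f g, G f -> G g -> G (f * g).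

Section adj.
Variables (q : B -> R) (sq : submult_seminorm q) (G : set B).

Lemma adj_rep1 a g : G g -> adj_rep q G (a * g) (q a).
Proof.
by move=> Gg; rewrite -[a * g]addr0 -[q a]addr0; apply: adj_repS => //; exact: adj_rep0.
Qed.

Lemma adj_rep_ge0 f t : adj_rep q G f t -> 0 <= t.
Proof. by elim=> // a g f' t' _ _ IH; rewrite addr_ge0 // sn_ge0. Qed.

Lemma adj_repD f g t u : adj_rep q G f t -> adj_rep q G g u -> adj_rep q G (f + g) (t + u).
Proof.
move=> Hf Hg; elim: Hf => [|a k f' t' Gk _ IH]; first by rewrite !add0r.
by rewrite -!addrA; apply: adj_repS.
Qed.

Hypothesis GM : monoid_set G.

Lemma adj_rep_nonempty f : [set t | adj_rep q G f t] !=set0.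
Proof. by exists (q f); have := adj_rep1 f GM.1; rewrite mulr1. Qed.

Lemma adj_repM1 a g f t : G g -> adj_rep q G f t ->
  exists2 u : R, u <= q a * t & adj_rep q G (a * g * f) u.
Proof.
move=> Gg; elim=> [|b k f' t' Gk _ [u ut IH]].
  by exists 0; rewrite ?mulr0 //; exact: adj_rep0.
exists (q (a * b) + u); first by rewrite mulrDr lerD // snM.
have -> : a * g * (b * k + f') = (a * b) * (g * k) + a * g * f' by ring.
by apply: adj_repS => //; apply: (GM.2).
Qed.

Lemma adj_repM f g t u : adj_rep q G f t -> adj_rep q G g u ->
  exists2 v : R, v <= t * u & adj_rep q G (f * g) v.
Proof.
move=> Hf Hg; elim: Hf => [|a k f' t' Gk _ [v vt IH]].
  by exists 0; rewrite ?mul0r //; exact: adj_rep0.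
have [w wt Hw] := adj_repM1 a Gk Hg.
by exists (w + v); rewrite mulrDl ?lerD //; exact: adj_repD.
Qed.

Lemma adj_le_rep f t : adj_rep q G f t -> adj q G f <= t.
Proof. by move=> Hf; apply: le_inf_elt => // u /adj_rep_ge0. Qed.

Lemma adj_le f : adj q G f <= q f.
Proof. by apply: adj_le_rep; have := adj_rep1 f GM.1; rewrite mulr1. Qed.

Lemma adj_contraction g : G g -> adj q G g <= 1.
Proof.
move=> Gg; apply: le_trans (sn1 sq); apply: adj_le_rep.
by have := adj_rep1 1 Gg; rewrite mul1r.
Qed.

Lemma adj_submult : submult_seminorm (adj q G).
Proof.
split.
- by move=> f; apply: lb_le_inf; [exact: adj_rep_nonempty|move=> t /adj_rep_ge0].
- move=> f g; apply: le_inf_add; [exact: adj_rep_nonempty..|].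
  by move=> t u Hf Hg; apply: adj_le_rep; exact: adj_repD.
- move=> a f; rewrite [leRHS]mulrC; apply: le_inf_mulr; first exact: adj_rep_nonempty.
    exact: normc_ge0.
  move=> t Hf; have [u ut Hu] := adj_repM1 (c a) (GM.1) Hf.
  apply: le_trans (_ : u <= _); first by apply: adj_le_rep; rewrite mulr1 in Hu.
  apply: le_trans ut _; rewrite mulrC ler_wpM2l ?(adj_rep_ge0 Hf) //.
  exact: snC.
- move=> f g; apply: le_inf_mul; [exact: adj_rep_nonempty..| | |].
  + by move=> t /adj_rep_ge0.
  + by move=> t /adj_rep_ge0.
  + move=> t u Hf Hg; have [v vt Hv] := adj_repM Hf Hg.
    by apply: le_trans vt; exact: adj_le_rep.
- by apply: adj_contraction; case: GM.
Qed.

(** For [C = 1] this is the maximality of [adj]. Applied to [q] itself, a larger [C] shows that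
    turning a power-bounded element into a contraction yields an equivalent seminorm. *)
Lemma le_adj s (C : R) f : submult_seminorm s -> (forall f, s f <= q f) ->
  0 <= C -> (forall g, G g -> s g <= C) -> s f <= adj q G f * C.
Proof.
move=> ss sle C0 sG; apply: le_inf_mulr => //; first exact: adj_rep_nonempty.
move=> t; elim=> [|a g f' t' Gg _ IH]; first by rewrite (sn0 ss) mul0r.
apply: le_trans (snD ss _ _) _; rewrite mulrDl lerD //.
apply: le_trans (snM ss _ _) _.
by apply: ler_pM => //; rewrite ?(sn_ge0 ss) // sG.
Qed.

End adj.

(** The terms of one representation are sorted by the set their [g] comes from, and neither part
    costs more than the whole. For the powers of a unit and of its inverse this splits a Laurent
    polynomial into its two halves. *)
Lemma adj_setU q G1 G2 f (e : R) : submult_seminorm q -> monoid_set (G1 `|` G2) ->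
  adj q (G1 `|` G2) f < e ->
  exists f1 f2, [/\ f = f1 + f2, adj q G1 f1 < e & adj q G2 f2 < e].
Proof.
move=> sq GM fe.
have [t Hf te] := inf_lt (adj_rep_nonempty q GM f) fe.
suff [f1 [f2 [t1 [t2 [-> H1 H2 tt]]]]] : exists f1 f2 t1 t2,
    [/\ f = f1 + f2, adj_rep q G1 f1 t1, adj_rep q G2 f2 t2 & t1 + t2 = t].
  have t1p := adj_rep_ge0 sq H1; have t2p := adj_rep_ge0 sq H2.
  exists f1, f2; split=> //.
    by apply: le_lt_trans (adj_le_rep sq H1) _; lra.
  by apply: le_lt_trans (adj_le_rep sq H2) _; lra.
elim: Hf {te fe} => [|a g f' t' Gg _ [f1 [f2 [t1 [t2 [-> H1 H2 tt]]]]]].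
  by exists 0, 0, 0, 0; split; rewrite ?addr0 //; exact: adj_rep0.
case: Gg => Gg.
  by exists (a * g + f1), f2, (q a + t1), t2; split;
    rewrite ?addrA -?tt ?addrA //; exact: adj_repS.
exists f1, (a * g + f2), t1, (q a + t2); split=> //.
- by rewrite addrCA.
- exact: adj_repS.
- by rewrite addrCA tt.
Qed.

Definition powers g : set B := [set f | exists n, f = g ^+ n].

Lemma monoid_powers g : monoid_set (powers g).
Proof.
split; first by exists 0%N.
by move=> _ _ [m ->] [n ->]; exists (m + n)%N; rewrite exprD.
Qed.

Lemma monoid_powersV g g' : g * g' = 1 -> monoid_set (powers g `|` powers g').
Proof.
move=> gg'.
have key m n : (powers g `|` powers g') (g ^+ m * g' ^+ n).
  have gX k : g ^+ k * g' ^+ k = 1 by rewrite -exprMn gg' expr1n.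
  have [mn|/ltnW mn] := leqP m n.
    by right; exists (n - m)%N; rewrite -{1}(subnKC mn) exprD mulrA gX mul1r.
  by left; exists (m - n)%N; rewrite -{1}(subnK mn) exprD -mulrA gX mulr1.
split; first by left; exists 0%N.
move=> f h [[m ->]|[m ->]] [[n ->]|[n ->]].
- by left; exists (m + n)%N; rewrite exprD.
- exact: key.
- by rewrite mulrC; exact: key.
- by right; exists (m + n)%N; rewrite exprD.
Qed.

End seminorms.

(** * Minimal seminorms and characters *)

Section power_lemmas.
Variable R : realType.

Lemma bernoulli (x : R) n : 0 <= x -> 1 + n%:R * x <= (1 + x) ^+ n.
Proof.
move=> x0; elim: n => [|n IH]; first by rewrite mul0r addr0 expr0.
have n0 : (0 : R) <= n%:R by [].
rewrite exprS; apply: le_trans (_ : (1 + x) * (1 + n%:R * x) <= _).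
  by rewrite -natr1; nra.
by rewrite ler_wpM2l // addr_ge0.
Qed.

(** A substitute for taking [n]-th roots and a limit: if [x < 1], Bernoulli's inequality for
    [x^-1 = 1 + d] would bound [1 + n d]. *)
Lemma ge1_of_powers (C x : R) : 0 <= x -> (forall n, 1 <= C * x ^+ n) -> 1 <= x.
Proof.
move=> x0 Cx; rewrite leNgt; apply/negP => x1.
have [x00|xn0] := eqVneq x 0.
  by have := Cx 1%N; rewrite x00 expr1 mulr0 ler10.
have xp : 0 < x by rewrite lt_neqAle eq_sym xn0.
pose d := x^-1 - 1.
have dp : 0 < d by rewrite subr_gt0 invf_gt1.
have xV : x^-1 = 1 + d by rewrite /d addrC subrK.
have bd n : 1 + n%:R * d <= C.
  apply: le_trans (bernoulli n (ltW dp)) _.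
  rewrite -xV exprVn -(mul1r (_^-1)) ler_pdivrMr ?exprn_gt0 //.
have := bd (Num.truncn (C / d)).+1.
have := truncnS_gt (C / d); rewrite ltr_pdivrMr //; lra.
Qed.

Lemma exists_half_power (C e : R) : 0 <= C -> 0 < e ->
  exists2 n, (0 < n)%N & C * 2^-1 ^+ n < e.
Proof.
move=> C0 e0; apply: contrapT => nC.
have nC1 n : (0 < n)%N -> e <= C * 2^-1 ^+ n.
  by move=> n0; rewrite leNgt; apply/negP => H; apply: nC; exists n.
have h0 : 0 < (2^-1 : R) by rewrite invr_gt0.
have : 1 <= (2^-1 : R).
  apply: (@ge1_of_powers (C / e)); first exact: ltW.
  move=> n; rewrite mulrAC ler_pdivlMr // mul1r; apply: le_trans (nC1 n.+1 _) _ => //.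
  by rewrite ler_wpM2l // exprS ler_piMl ?exprn_ge0 ?(ltW h0) // invf_le1 // ler1n.
lra.
Qed.

End power_lemmas.

Section gelfand.
Variables (R : realType) (B : comPzRingType) (c : {rmorphism R[i] -> B}).
Implicit Types (q s : B -> R) (f g h : B).
Local Notation submult := (submult_seminorm c).

Definition spread q h (rho : R) : set (B -> R) :=
  [set s | [/\ submult s, forall f, s f <= q f & forall n, rho ^+ n <= s (h ^+ n)]].

Lemma spread_minimal q h rho : spread q h rho q ->
  exists2 s, spread q h rho s &
    forall s', spread q h rho s' -> (forall f, s' f <= s f) -> s' = s.
Proof.
move=> qS; pose T := {s | spread q h rho s}.
(* The order is reversed, so that the maximal elements of Zorn's lemma are minimal seminorms. *)
pose le (s t : T) := `[< forall f, sval t f <= sval s f >].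
have [| | | |[s sS] smin] := @Zorn T le.
- by move=> t; exact/asboolP.
- by move=> r s t /asboolP rs /asboolP st; apply/asboolP => f; exact: le_trans (st f) (rs f).
- move=> [s sS] [t tS] /asboolP st /asboolP ts; apply: eq_exist => /=.
  by apply/funext => f; apply/le_anti; rewrite st ts.
(* Adding [q] to the chain keeps the infima over nonempty sets, even for the empty chain. *)
- move=> A Atot; pose D := [set s | s = q \/ exists2 t : T, A t & s = sval t].
  have DS s : D s -> spread q h rho s by case=> [->//|[t _ ->]]; exact: (svalP t).
  have Dtot s t : D s -> D t -> (forall f, s f <= t f) \/ (forall f, t f <= s f).
    case=> [->|[s' As ->]] Dt.
      by right=> f; have [_ H _] := DS _ Dt.
    case: Dt => [->|[t' At ->]].
      by left=> f; have [_ H _] := svalP s'.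
    by have [/asboolP H|/asboolP H] := Atot _ _ As At; [right|left].
  pose E f := [set s f | s in D].
  have E0 f : E f !=set0 by exists (q f), q => //; left.
  have Ege f t : E f t -> 0 <= t by move=> [s /DS[ss _ _] <-]; exact: (sn_ge0 ss).
  pose m f := inf (E f).
  have mle s f : D s -> m f <= s f by move=> Ds; apply: le_inf_elt; [exact: Ege|exists s].
  have mS : spread q h rho m.
    split; last 2 first.
    + by move=> f; apply: mle; left.
    + move=> n; apply: lb_le_inf; first exact: E0.
      by move=> _ [s /DS[_ _ H] <-].
    split.
    + by move=> f; apply: lb_le_inf; [exact: E0|exact: Ege].
    + move=> f g; apply: le_inf_add; [exact: E0..|].
      move=> _ _ [s Ds <-] [t Dt <-].
      have [st|ts] := Dtot _ _ Ds Dt.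
        have [ss _ _] := DS _ Ds.
        by apply: le_trans (mle _ _ Ds) (le_trans (snD ss _ _) _); rewrite lerD2l.
      have [tt _ _] := DS _ Dt.
      by apply: le_trans (mle _ _ Dt) (le_trans (snD tt _ _) _); rewrite lerD2r.
    + move=> a f; rewrite [leRHS]mulrC; apply: le_inf_mulr; [exact: E0|exact: normc_ge0|].
      move=> _ [s Ds <-]; have [ss _ _] := DS _ Ds.
      by apply: le_trans (mle _ _ Ds) _; rewrite [leRHS]mulrC; exact: (snZ ss).
    + move=> f g; apply: le_inf_mul; [exact: E0|exact: E0|exact: Ege|exact: Ege|].
      move=> _ _ [s Ds <-] [t Dt <-].
      have [ss _ _] := DS _ Ds; have [tt _ _] := DS _ Dt.
      have [st|ts] := Dtot _ _ Ds Dt.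
        apply: le_trans (mle _ _ Ds) (le_trans (snM ss _ _) _).
        by rewrite ler_wpM2l // (sn_ge0 ss).
      apply: le_trans (mle _ _ Dt) (le_trans (snM tt _ _) _).
      by rewrite ler_wpM2r // (sn_ge0 tt).
    + by apply: le_trans (mle q _ _) _; [left|have [] := qS => + _ _; exact: sn1].
  exists (exist _ m mS) => t At; apply/asboolP => f /=.
  by apply: mle; right; exists t.
- exists s => // s' s'S s's; have := smin (exist _ s' s'S).
  by move=> /(_ (introT (asboolP _) s's)) [].
Qed.

Section minimal.
Variables (q s : B -> R) (h : B) (rho : R).
Hypotheses (rho0 : 0 < rho) (sS : spread q h rho s)
  (smin : forall s', spread q h rho s' -> (forall f, s' f <= s f) -> s' = s).

Let ss : submult s. Proof. by case: sS. Qed.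

Lemma minimal_s1 : s 1 = 1.
Proof.
by apply/le_anti; rewrite (sn1 ss) /=; have [_ _ /(_ 0%N)] := sS; rewrite !expr0.
Qed.

(** The powers of [u = g / r] are bounded by [C], so making them contractions gives a seminorm below
    [s] that is still in [spread q h rho]. By minimality it equals [s], whence [s u <= 1]. *)
Lemma minimal_power_le g (r C : R) : 0 < r -> (forall n, s (g ^+ n) <= C * r ^+ n) -> s g <= r.
Proof.
move=> r0 gC; pose u := c (r^-1)%:C%C * g.
have normr : normc (r^-1)%:C%C = r^-1 by rewrite normc_real ger0_norm // invr_ge0 ltW.
have uC n : s (u ^+ n) <= C.
  rewrite exprMn -rmorphXn; apply: le_trans (snZ ss _ _) _.
  by rewrite normcX normr exprVn ler_pdivrMl ?exprn_gt0 // mulrC.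
have GM := monoid_powers u.
have as' := adj_submult ss GM.
have C0 : 0 <= C by apply: le_trans (uC 0%N); exact: (sn_ge0 ss).
have C1 : 1 <= C by apply: le_trans (uC 0%N); rewrite expr0 minimal_s1.
have sadj f : s f <= adj s (powers u) f * C.
  by apply: (le_adj GM f ss) => // _ [n ->].
have aS : spread q h rho (adj s (powers u)).
  split=> // [f|n].
    by apply: le_trans (adj_le ss GM f) _; case: sS.
  have rn : 0 < rho ^+ n by rewrite exprn_gt0.
  rewrite -(mul1r (rho ^+ n)) -ler_pdivlMr //.
  (* The lower bound is known only up to the factor [C]; using it at the exponents [n * k] for all
     [k] removes that factor. *)
  apply: (@ge1_of_powers _ C); first by rewrite divr_ge0 ?(sn_ge0 as') // ltW.
  move=> k; rewrite expr_div_n mulrA ler_pdivlMr ?exprn_gt0 // mul1r -exprM.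
  have [_ _ /(_ (n * k)%N) H] := sS; apply: le_trans H _.
  apply: le_trans (sadj _) _; rewrite mulrC ler_wpM2l //.
  by rewrite exprM; exact: (snX as').
have us : s u <= 1.
  rewrite -(smin aS); last by move=> f; exact: (adj_le ss GM).
  by apply: (adj_contraction ss); exists 1%N.
have -> : g = c r%:C%C * u.
  rewrite /u mulrA -rmorphM /= -(rmorphM (real_complex R)) mulfV ?gt_eqF //.
  by rewrite rmorph1 mul1r.
apply: le_trans (snZ ss _ _) _; rewrite normc_real gtr0_norm //.
by rewrite ler_piMr // ltW.
Qed.

(** Otherwise take [t] strictly between the two sides: the powers of [g] are controlled by those of
    the square root of [t], and [minimal_power_le] contradicts the choice of [t]. *)
Lemma minimal_sqr g : s g ^+ 2 <= s (g ^+ 2).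
Proof.
rewrite leNgt; apply/negP => gs; have g0 := sn_ge0 ss g.
pose t := (s (g ^+ 2) + s g ^+ 2) / 2; have g20 := sn_ge0 ss (g ^+ 2).
have t0 : 0 < t by rewrite divr_gt0 // ltr_wpDl // (le_lt_trans _ gs).
have st : Num.sqrt t ^+ 2 = t by rewrite sqr_sqrtr // ltW.
have rt0 : 0 < Num.sqrt t by rewrite sqrtr_gt0.
have [||C _ gC] := power_bounded ss (m := 2) (f := g) rt0.
- by [].
- by rewrite st /t; lra.
have := minimal_power_le rt0 gC.
rewrite leNgt => /negP; apply.
by rewrite -(ltr_pXn2r (n := 2)) ?nnegrE ?(ltW rt0) // st /t; lra.
Qed.

(** Repeated squaring handles the exponents [2 ^ k]; for general [n] the factor [s g ^+ (2 ^ n - n)]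
    is cancelled. *)
Lemma minimal_power g n : s (g ^+ n) = s g ^+ n.
Proof.
apply/le_anti; rewrite (snX ss) /=.
have pow2 k : s g ^+ (2 ^ k) <= s (g ^+ (2 ^ k)).
  elim: k => [|k IH]; first by rewrite !expr1.
  rewrite expnS mulnC !exprM; apply: le_trans (minimal_sqr _).
  by rewrite lerXn2r // nnegrE ?exprn_ge0 // (sn_ge0 ss).
have [g0|gn0] := eqVneq (s g) 0.
  rewrite g0 expr0n; case: n => [|n]; first by rewrite expr0 minimal_s1.
  exact: (sn_ge0 ss).
have gp : 0 < s g by rewrite lt_neqAle eq_sym gn0 (sn_ge0 ss).
have n2 : (n <= 2 ^ n)%N by rewrite ltnW // ltn_expl.
have := pow2 n; rewrite -(subnK n2) !exprD => H.
rewrite -(ler_pM2l (exprn_gt0 (2 ^ n - n) gp)).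
apply: le_trans H (le_trans (snM ss _ _) _).
by rewrite ler_wpM2r ?(sn_ge0 ss) // (snX ss).
Qed.

(* [s_g f = inf_n s (f g^n) / s(g)^n] is another member of the family below [s]. *)
Lemma minimal_mul_of g : 0 < s g ->
  (forall n k, rho ^+ n * s g ^+ k <= s (h ^+ n * g ^+ k)) ->
  forall f, s (f * g) = s f * s g.
Proof.
move=> g0 hg; pose v f n : R := s (f * g ^+ n) / s g ^+ n.
pose E f := [set v f n | n in setT].
have gn0 n : 0 < s g ^+ n by rewrite exprn_gt0.
have v0 f n : 0 <= v f n by rewrite divr_ge0 ?(sn_ge0 ss) // ltW.
have E0 f : E f !=set0 by exists (v f 0%N), 0%N.
have Ege f t : E f t -> 0 <= t by move=> [n _ <-].
pose m f := inf (E f).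
have mle f n : m f <= v f n by apply: le_inf_elt; [exact: Ege|exists n].
(* Monotonicity in the index lets [i + j] serve two infima at once in the proof of subadditivity. *)
have vdec f n k : v f (n + k)%N <= v f n.
  have e : s (f * g ^+ n) / s g ^+ n * s g ^+ (n + k) = s (f * g ^+ n) * s g ^+ k.
    by rewrite exprD mulrA divfK // gt_eqF.
  rewrite /v ler_pdivrMr // e exprD mulrA.
  by apply: le_trans (snM ss _ _) _; rewrite minimal_power.
have mf f : m f <= s f by apply: le_trans (mle f 0%N) _; rewrite /v !expr0 mulr1 divr1.
have mS : spread q h rho m.
  split; last 2 first.
  - by move=> f; apply: le_trans (mf f) _; case: sS.
  - move=> n; apply: lb_le_inf; first exact: E0.
    by move=> _ [k _ <-]; rewrite /v ler_pdivlMr.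
  split.
  - by move=> f; apply: lb_le_inf; [exact: E0|exact: Ege].
  - have vD f k n : v (f + k) n <= v f n + v k n :> R.
      rewrite /v -mulrDl ler_pM2r ?invr_gt0 //.
      by rewrite mulrDl; exact: (snD ss).
    move=> f k; apply: le_inf_add; [exact: E0..|].
    move=> _ _ [i _ <-] [j _ <-]; apply: le_trans (mle _ (i + j)%N) _.
    apply: le_trans (vD _ _ _) _.
    by apply: lerD; [exact: vdec|rewrite addnC; exact: vdec].
  - move=> a f; rewrite [leRHS]mulrC; apply: le_inf_mulr; [exact: E0|exact: normc_ge0|].
    move=> _ [n _ <-]; apply: le_trans (mle _ n) _.
    rewrite /v [leRHS]mulrAC ler_pM2r ?invr_gt0 // -mulrA [leRHS]mulrC.
    exact: (snZ ss).
  - move=> f k; apply: le_inf_mul; [exact: E0|exact: E0|exact: Ege|exact: Ege|].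
    move=> _ _ [i _ <-] [j _ <-]; apply: le_trans (mle _ (i + j)%N) _.
    rewrite /v mulf_div -exprD ler_pM2r ?invr_gt0 //.
    by rewrite exprD mulrACA; exact: (snM ss).
  - by apply: le_trans (mf _) _; exact: (sn1 ss).
move=> f; apply/le_anti; rewrite (snM ss) /=.
rewrite -ler_pdivlMr // -{1}(smin mS mf).
by apply: le_trans (mle f 1%N) _; rewrite /v !expr1.
Qed.

(** [minimal_mul_of] is used twice. For [h] it follows from [minimal_power] and [rho <= s h];
    multiplicativity in [h] then supplies its hypothesis for general [g]. *)
Lemma minimal_mul f g : s (f * g) = s f * s g.
Proof.
have hp : rho <= s h by have [_ _ /(_ 1%N)] := sS; rewrite !expr1.
have h0 : 0 < s h by exact: lt_le_trans hp.
have hmul : forall f, s (f * h) = s f * s h.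
  apply: minimal_mul_of => // n k; rewrite -exprD minimal_power exprD.
  by rewrite ler_wpM2r ?exprn_ge0 ?(ltW h0) // lerXn2r // nnegrE ltW.
have hnmul n f' : s (h ^+ n * f') = s h ^+ n * s f'.
  elim: n => [|n IH]; first by rewrite !expr0 !mul1r.
  by rewrite exprS -mulrA mulrC hmul IH exprS; ring.
have [g0|gn0] := eqVneq (s g) 0.
  apply/le_anti; rewrite (snM ss) /= g0 mulr0; exact: (sn_ge0 ss).
have gp : 0 < s g by rewrite lt_neqAle eq_sym gn0 (sn_ge0 ss).
apply: minimal_mul_of => // n k; rewrite hnmul minimal_power.
by rewrite ler_wpM2r ?exprn_ge0 ?(ltW gp) // lerXn2r // nnegrE ltW.
Qed.

End minimal.
End gelfand.

Record is_char (R : realType) (B : comPzRingType) (c : {rmorphism R[i] -> B})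
    (phi : B -> R[i]) : Prop := IsChar {
  charD : forall f g, phi (f + g) = phi f + phi g;
  charM : forall f g, phi (f * g) = phi f * phi g;
  charC : forall a, phi (c a) = a }.

(** * The Gelfand-Mazur theorem for multiplicative seminorms *)

Section gelfand_mazur.
Variables (R : realType) (B : comPzRingType) (c : {rmorphism R[i] -> B}).
Variables (s : B -> R) (ss : submult_seminorm c s) (s1 : s 1 = 1)
  (sM : forall f g, s (f * g) = s f * s g).
Implicit Types (f g h : B).

Lemma mult_snC a : s (c a) = normc a.
Proof.
have [->|a0] := eqVneq a 0; first by rewrite rmorph0 (sn0 ss) normc0.
apply/le_anti; rewrite (snC ss) /=.
have na0 : 0 < normc a.
  by rewrite lt_neqAle normc_ge0 andbT eq_sym; apply: contra_neq a0 => /eq0_normc.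
have := sM (c a) (c a^-1); rewrite -rmorphM mulfV // rmorph1 s1 => e.
have := snC ss a^-1; rewrite normcV => H.
have sa := sn_ge0 ss (c a).
have : 1 <= s (c a) * (normc a)^-1 by rewrite e ler_wpM2l.
by rewrite ler_pdivlMr // mul1r.
Qed.

Section extremal.
Variables (h : B) (m : R) (m0 : 0 < m) (hm : forall a, m <= s (h - c a)).

Lemma extremal_pow2 j a : m ^+ (2 ^ j) <= s (h ^+ (2 ^ j) - c a).
Proof.
elim: j a => [|j IH] a; first by rewrite !expr1.
have -> : h ^+ (2 ^ j.+1) - c a =
    (h ^+ (2 ^ j) - c (sqrtc a)) * (h ^+ (2 ^ j) - c (- sqrtc a)).
  rewrite expnS mulnC exprM -{1}(sqr_sqrtc a) rmorphXn rmorphN /=; ring.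
rewrite sM expnS mulnC exprM expr2; apply: ler_pM => //.
  by rewrite exprn_ge0 // ltW.
by rewrite exprn_ge0 // ltW.
Qed.

(** A difference of squares is factored; the factor with [- a ^+ (2 ^ j)] is at least [m ^+ (2 ^ j)]
    by [extremal_pow2]. *)
Lemma extremal_factor j a :
  s (h - c a) * m ^+ (2 ^ j) <= m * s (h ^+ (2 ^ j) - c (a ^+ (2 ^ j))).
Proof.
elim: j => [|j IH]; first by rewrite !expr1 mulrC.
have -> : h ^+ (2 ^ j.+1) - c (a ^+ (2 ^ j.+1)) =
    (h ^+ (2 ^ j) - c (a ^+ (2 ^ j))) * (h ^+ (2 ^ j) - c (- a ^+ (2 ^ j))).
  rewrite expnS mulnC !exprM (rmorphXn c) rmorphN /=; ring.
rewrite sM expnS mulnC exprM expr2 !mulrA; apply: ler_pM => //.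
- by rewrite mulr_ge0 ?(sn_ge0 ss) // exprn_ge0 // ltW.
- by rewrite exprn_ge0 // ltW.
- exact: extremal_pow2.
Qed.

(** By [extremal_factor], [s (h - c a) / m] exceeds one by at most [(normc a / m) ^+ (2 ^ j)], which
    tends to zero. *)
Lemma extremal_shift a : s h = m -> normc a < m -> s (h - c a) <= m.
Proof.
move=> shm am; have sa := sn_ge0 ss (h - c a).
have na := normc_ge0 a.
rewrite -(mul1r m) -ler_pdivrMr //.
pose r := normc a / m.
have r0 : 0 <= r by rewrite divr_ge0 // ltW.
have r1 : r < 1 by rewrite ltr_pdivrMr // mul1r.
have bd j : s (h - c a) / m <= 1 + r ^+ (2 ^ j).
  have mj : 0 < m ^+ (2 ^ j) by rewrite exprn_gt0.
  rewrite ler_pdivrMr // -(ler_pM2r mj).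
  apply: le_trans (extremal_factor j a) _.
  have -> : (1 + r ^+ (2 ^ j)) * m * m ^+ (2 ^ j) =
      m * (m ^+ (2 ^ j) + normc a ^+ (2 ^ j)).
    rewrite /r expr_div_n; field; by rewrite gt_eqF.
  rewrite ler_pM2l //; apply: le_trans (snB ss _ _) _.
  apply: lerD; first by rewrite -shm (snX ss).
  by rewrite -normcX (snC ss).
rewrite leNgt; apply/negP => H.
pose e := s (h - c a) / m - 1.
have e0 : 0 < e by rewrite subr_gt0.
have re j : e <= r ^+ (2 ^ j) by rewrite lerBlDl.
have : 1 <= r.
  apply: (@ge1_of_powers _ e^-1) => // n.
  rewrite ler_pdivlMl // mulr1; apply: le_trans (re n) _.
  by rewrite ler_wiXn2l ?(ltW r1) // ltnW // ltn_expl.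
by rewrite leNgt r1.
Qed.

End extremal.

(** By [extremal_shift] the value [m] persists under repeated translation by [m / 2]. Five
    translations move [h] by [5 m / 2], more than the [2 m] that the triangle inequality allows. *)
Lemma no_extremal h m : 0 < m -> s h = m -> ~ (forall a, m <= s (h - c a)).
Proof.
move=> m0 shm hm; pose a : R[i] := (m / 2)%:C%C.
have na : normc a < m by rewrite normc_real ger0_norm; lra.
have key n : s (h - c (a *+ n)) = m.
  elim: n => [|n IH]; first by rewrite mulr0n rmorph0 subr0.
  apply/le_anti; rewrite hm andbT mulrSr rmorphD /= opprD addrA.
  apply: extremal_shift => // b.
  by rewrite -addrA -opprD -rmorphD.
have k5 := key 5%N.
have : s (c (a *+ 5)) <= m + m.
  by have := snB ss h (h - c (a *+ 5)); rewrite subKr shm k5.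
rewrite mult_snC -mulr_natr normcM normc_nat normc_real ger0_norm; lra.
Qed.

Lemma continuous_sn_affine f :
  continuous (fun z : R * R => s (f - c (z.1 +i* z.2)%C)).
Proof.
have normc_le (x y : R) : normc (x +i* y)%C <= `|x| + `|y|.
  have xy0 : 0 <= `|x| + `|y| by rewrite addr_ge0.
  rewrite /= -[leRHS]ger0_norm // -sqrtr_sqr ler_wsqrtr // sqrrD !real_normK ?num_real //.
  by rewrite lerD2r lerDl mulrn_wge0 // mulr_ge0.
have lip (z w : R * R) : s (f - c (z.1 +i* z.2)%C) - s (f - c (w.1 +i* w.2)%C) <=
    `|z.1 - w.1| + `|z.2 - w.2|.
  have e : f - c (z.1 +i* z.2)%C =
      c ((w.1 - z.1) +i* (w.2 - z.2))%C + (f - c (w.1 +i* w.2)%C).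
    have -> : ((w.1 - z.1) +i* (w.2 - z.2))%C = (w.1 +i* w.2)%C - (z.1 +i* z.2)%C by [].
    by rewrite rmorphB /=; ring.
  have := snD ss (c ((w.1 - z.1) +i* (w.2 - z.2))%C) (f - c (w.1 +i* w.2)%C).
  rewrite -e (distrC z.1) (distrC z.2).
  have := snC ss ((w.1 - z.1) +i* (w.2 - z.2))%C.
  have := normc_le (w.1 - z.1) (w.2 - z.2); lra.
move=> z; apply/cvgrPdist_le => e e0.
have e2 : 0 < e / 2 by rewrite divr_gt0.
have [/cvgrPdist_le/(_ _ e2) c1 /cvgrPdist_le/(_ _ e2) c2] :
  ((w.1 @[w --> z] --> z.1) * (w.2 @[w --> z] --> z.2))%type.
  by split; [exact: cvg_fst|exact: cvg_snd].
near=> w.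
have w1 : `|z.1 - w.1| <= e / 2 by near: w.
have w2 : `|z.2 - w.2| <= e / 2 by near: w.
have := lip z w; have := lip w z.
rewrite (distrC w.1) (distrC w.2) ler_norml; lra.
Unshelve. all: by end_near. Qed.

Lemma gelfand_mazur f : exists a, s (f - c a) = 0.
Proof.
(* Beyond modulus [K] the triangle inequality makes [s (f - c a)] exceed [s f], its value at
   [a = 0], so the minimum over the square is global. *)
pose K := s f + s f + 1.
have K0 : 0 <= K by rewrite /K !addr_ge0 ?(sn_ge0 ss).
pose F (z : R * R) := s (f - c (z.1 +i* z.2)%C).
pose D : set (R * R) := `[- K, K] `*` `[- K, K].
have D00 : D (0, 0) by split; rewrite /= in_itv /= oppr_le0 K0.
have [|||[x y] _ zmin] := @compact_EVT_min _ _ F D.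
- by exists (0, 0).
- by apply: compact_setX; exact: segment_compact.
- exact/continuous_subspaceT/continuous_sn_affine.
exists (x +i* y)%C; apply: contrapT => /eqP n0.
have m0 : 0 < s (f - c (x +i* y)%C) by rewrite lt_neqAle eq_sym n0 (sn_ge0 ss).
apply: (no_extremal m0 erefl) => b.
have -> : f - c (x +i* y)%C - c b = f - c ((x +i* y)%C + b).
  by rewrite rmorphD opprD addrA.
case: (_ + b) => u v.
have F0 : F (x, y) <= s f.
  have := zmin (0, 0); rewrite /F /= => H; apply: le_trans (H _) _; first exact/mem_set.
  by rewrite (_ : (0 +i* 0)%C = 0) // rmorph0 subr0.
have [uv|] := pselect (D (u, v)); first by apply: (zmin (u, v)); exact/mem_set.
move=> nD; apply: le_trans F0 _.
have : K < normc (u +i* v)%C.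
  rewrite ltNge; apply/negP => uvK; apply: nD.
  have H2 : u ^+ 2 + v ^+ 2 <= K ^+ 2.
    by rewrite -ler_sqrt ?sqr_ge0 // sqrtr_sqr (ger0_norm K0).
  by split; rewrite /= in_itv /= -ler_norml -ler_sqr ?nnegrE //
    real_normK ?num_real //; [have := sqr_ge0 v|have := sqr_ge0 u]; lra.
have := snB ss f (f - c (u +i* v)%C); rewrite subKr mult_snC /K; lra.
Qed.

(** The scalar given by [gelfand_mazur] is unique, and uniqueness makes it additive and
    multiplicative in [f]. *)
Lemma mult_sn_char : exists2 phi, is_char c phi & forall f, normc (phi f) = s f.
Proof.
have [phi phiE] := choice gelfand_mazur.
have uniq f a : s (f - c a) = 0 -> phi f = a.
  move=> fa; apply/eqP; rewrite -subr_eq0; apply/eqP/eq0_normc/le_anti.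
  rewrite normc_ge0 andbT -mult_snC rmorphB /=.
  have -> : c (phi f) - c a = (f - c a) - (f - c (phi f)) by ring.
  by apply: le_trans (snB ss _ _) _; rewrite fa phiE addr0.
exists phi; first split.
- move=> f g; apply/uniq/le_anti; rewrite (sn_ge0 ss) andbT rmorphD /=.
  have -> : f + g - (c (phi f) + c (phi g)) = (f - c (phi f)) + (g - c (phi g)) by ring.
  by apply: le_trans (snD ss _ _) _; rewrite !phiE addr0.
- move=> f g; apply/uniq/le_anti; rewrite (sn_ge0 ss) andbT rmorphM /=.
  have -> : f * g - c (phi f) * c (phi g) =
      (f - c (phi f)) * g + c (phi f) * (g - c (phi g)) by ring.
  by apply: le_trans (snD ss _ _) _; rewrite !sM !phiE mul0r mulr0 addr0.
- by move=> a; apply: uniq; rewrite subrr (sn0 ss).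
move=> f; rewrite -mult_snC; apply/le_anti/andP; split.
- rewrite -(subKr f (c (phi f))); apply: le_trans (snB ss _ _) _.
  by rewrite phiE addr0.
- by rewrite -{1}(subrK (c (phi f)) f); apply: le_trans (snD ss _ _) _; rewrite phiE add0r.
Qed.

End gelfand_mazur.

(** The spectral radius formula in contrapositive form: if [rho] does not control the powers of [h],
    a character dominated by [q] witnesses it. *)
Theorem exists_char (R : realType) (B : comPzRingType) (c : {rmorphism R[i] -> B})
    (q : B -> R) (h : B) (rho : R) :
  submult_seminorm c q -> 0 < rho ->
  ~ (exists2 C : R, 0 <= C & forall n, q (h ^+ n) <= C * rho ^+ n) ->
  exists phi, [/\ is_char c phi, forall f, normc (phi f) <= q f & rho <= normc (phi h)].
Proof.
move=> sq rho0 nC.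
have qS : spread c q h rho q.
  split=> // n; rewrite leNgt; apply/negP => hn; apply: nC.
  (* [power_bounded] needs a positive exponent. At exponent zero the assumption reads [q 1 < 1],
     which forces [q 1 = 0] and hence [q = 0]. *)
  case: n hn => [|n] hn; last by apply: (power_bounded sq (m := n.+1)) => //; exact: ltW.
  have q10 : q 1 = 0.
    have := snM sq 1 1; rewrite mulr1 => H; have := sn_ge0 sq 1.
    move: hn; rewrite !expr0; nra.
  exists 0 => // m; rewrite mul0r -[h ^+ m]mulr1.
  by apply: le_trans (snM sq _ _) _; rewrite q10 mulr0.
have [s sS smin] := spread_minimal qS.
have [ss sle sh] := sS.
have sM := minimal_mul rho0 sS smin.
have [phi phic phiE] := mult_sn_char ss (minimal_s1 sS) sM.
exists phi; split=> // [f|]; first by rewrite phiE.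
by rewrite phiE; have := sh 1%N; rewrite !expr1.
Qed.

(** * Newton's iteration for idempotents *)

Section char_lemmas.
Variables (R : realType) (B : comPzRingType) (c : {rmorphism R[i] -> B}).
Variables (phi : B -> R[i]) (phic : is_char c phi).

Lemma char1 : phi 1 = 1.
Proof. by rewrite -(rmorph1 c) (charC phic). Qed.

Lemma charN f : phi (- f) = - phi f.
Proof. by rewrite -mulN1r -(rmorphN1 c) (charM phic) (charC phic) mulN1r. Qed.

Lemma charB f g : phi (f - g) = phi f - phi g.
Proof. by rewrite (charD phic) charN. Qed.

Lemma charX f n : phi (f ^+ n) = phi f ^+ n.
Proof. by elim: n => [|n IH]; rewrite ?char1 // !exprS (charM phic) IH. Qed.

Lemma char_nat n : phi n%:R = n%:R.
Proof. by rewrite -(rmorph_nat c) (charC phic). Qed.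

Lemma char_submult : submult_seminorm c (fun f => normc (phi f)).
Proof.
split=> [f|f g|a f|f g|].
- exact: normc_ge0.
- by rewrite (charD phic) normcD.
- by rewrite (charM phic) (charC phic) normcM.
- by rewrite (charM phic) normcM.
- by rewrite char1 normc1.
Qed.

End char_lemmas.

Section newton.

(** The polynomial fixes [0] and [1] with zero derivative there. Any commutative ring is allowed
    because the step is applied both to functions and to their values. *)
Definition idem_step (B : comPzRingType) (x : B) : B := x ^+ 2 * (3%:R - 2%:R * x).

Lemma char_idem_step (R : realType) (B : comPzRingType) (c : {rmorphism R[i] -> B})
    (phi : B -> R[i]) x :
  is_char c phi -> phi (idem_step x) = idem_step (phi x).
Proof.
move=> pc; rewrite /idem_step (charM pc) (charX pc) (charB pc) (charM pc).
by rewrite !(char_nat pc).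
Qed.

Variables (R : realType) (B : comPzRingType) (c : {rmorphism R[i] -> B}).
Variables (q : B -> R) (sq : submult_seminorm c q).

(** The derivative [6 u (1 - u)] of the step is six times the defect [u - u ^+ 2]: nearby almost
    idempotent elements are drawn together while the defect shrinks quadratically. The bound on
    [2 u - 1] grows by at most [2^-1 ^+ n.+1] at step [n], hence the form [3 - 2^-1 ^+ n]. *)
Lemma idem_iter_bounds (x y : B) : q (x - x ^+ 2) <= 1 / 50 -> q (2%:R * x - 1) <= 2 ->
  q (x - y) <= 1 / 50 ->
  forall n, let x' := iter n (@idem_step B) x in let y' := iter n (@idem_step B) y in
  [/\ q (x' - x' ^+ 2) <= 1 / 50 * 2^-1 ^+ n, q (2%:R * x' - 1) <= 3 - 2^-1 ^+ n &
      q (x' - y') <= 1 / 50 * 2^-1 ^+ n].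
Proof.
move=> bx wx dxy n; elim: n => [|n]; first by rewrite /= !expr0 !mulr1; split=> //; lra.
rewrite /= (exprS (2^-1 : R) n); set u := iter n _ x; set v := iter n _ y.
set e : R := 2^-1 ^+ n => -[].
have e0 : 0 <= e by rewrite exprn_ge0.
have e1 : e <= 1 by rewrite exprn_ile1 // invf_le1 // ler1n.
set b := u - u ^+ 2; set w := 2%:R * u - 1; set d := u - v => bu wu du.
have b0 := sn_ge0 sq b; have w0 := sn_ge0 sq w; have d0 := sn_ge0 sq d.
have M := snM sq; have D := snD sq.
have n3 := sn_nat sq 3.
have nle k f : q (k%:R * f) <= k%:R * q f.
  by apply: le_trans (M _ _) _; rewrite ler_wpM2r ?(sn_ge0 sq) // (sn_nat sq).
split.
- have -> : idem_step u - idem_step u ^+ 2 = b * b * (3%:R + 4%:R * b).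
    by rewrite /idem_step /b; ring.
  have H1 : q (3%:R + 4%:R * b) <= 4.
    by apply: le_trans (D _ _) _; have := nle 4%N b; lra.
  have H0 := sn_ge0 sq (3%:R + 4%:R * b).
  have Hbb := M b b; have Hbb0 := sn_ge0 sq (b * b).
  apply: le_trans (M _ _) _.
  apply: le_trans (_ : q b * q b * 4 <= _); first exact: ler_pM.
  have : q b * q b <= 1 / 50 * e * (1 / 50) by apply: ler_pM => //; lra.
  lra.
- have -> : 2%:R * idem_step u - 1 = w + 2%:R * b * w.
    by rewrite /idem_step /b /w; ring.
  apply: le_trans (D _ _) _; have H1 := M (2%:R * b) w; have H2 := nle 2%N b.
  have H3 : q (2%:R * b) * q w <= 2 * (1 / 50 * e) * 3.
    by apply: ler_pM; rewrite ?(sn_ge0 sq) //; lra.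
  lra.
- have -> : idem_step u - idem_step v = d * (6%:R * b + d * (3%:R * w - 2%:R * d)).
    by rewrite /idem_step /b /w /d; ring.
  have H1 : q (3%:R * w - 2%:R * d) <= 10.
    by apply: le_trans (snB sq _ _) _; have := nle 3%N w; have := nle 2%N d; lra.
  have H2 : q (d * (3%:R * w - 2%:R * d)) <= 1 / 50 * 10.
    apply: le_trans (M _ _) _; apply: ler_pM; rewrite ?(sn_ge0 sq) //; lra.
  have H3 : q (6%:R * b + d * (3%:R * w - 2%:R * d)) <= 2^-1.
    by apply: le_trans (D _ _) _; have := nle 6%N b; lra.
  apply: le_trans (M _ _) _; rewrite mulrCA [leRHS]mulrC.
  by apply: ler_pM; rewrite ?(sn_ge0 sq).
Qed.

End newton.

Section newton_complex.
Variable R : realType.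

Lemma idem_step_near0 (z : R[i]) (e : R) : e <= 1 / 200 -> normc z <= e ->
  normc (idem_step z) <= e / 2.
Proof.
move=> e1 ze; have z0 := normc_ge0 z.
rewrite /idem_step normcM normcX.
have n3 := normc_nat R 3; have n2 := normc_nat R 2.
have H : normc (3%:R - 2%:R * z) <= 4.
  apply: le_trans (normcD _ _) _; rewrite normcN normcM n2 n3; lra.
have H4 : normc z ^+ 2 * normc (3%:R - 2%:R * z) <= normc z ^+ 2 * 4.
  by rewrite ler_wpM2l // exprn_ge0.
have : normc z * normc z <= e * (1 / 200) by apply: ler_pM => //; lra.
move: H4; rewrite expr2; lra.
Qed.

Lemma idem_step1B (z : R[i]) : 1 - idem_step z = idem_step (1 - z).
Proof. by rewrite /idem_step; ring. Qed.

Lemma idem_step_near1 (z : R[i]) (e : R) : e <= 1 / 200 -> normc (1 - z) <= e ->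
  normc (1 - idem_step z) <= e / 2.
Proof. by rewrite idem_step1B; exact: idem_step_near0. Qed.

Lemma idem_iter_near0 (z : R[i]) n : normc z <= 1 / 200 ->
  normc (iter n (@idem_step R[i]) z) <= 1 / 200 * 2^-1 ^+ n.
Proof.
move=> z1; elim: n => [|n IH]; first by rewrite expr0 mulr1.
rewrite exprSr mulrA; apply: idem_step_near0 => //.
by rewrite ler_piMr // exprn_ile1 // invf_le1 // ler1n.
Qed.

Lemma idem_iter_near1 (z : R[i]) n : normc (1 - z) <= 1 / 200 ->
  normc (1 - iter n (@idem_step R[i]) z) <= 1 / 200 * 2^-1 ^+ n.
Proof.
move=> z1; elim: n => [|n IH]; first by rewrite expr0 mulr1.
rewrite exprSr mulrA; apply: idem_step_near1 => //.
by rewrite ler_piMr // exprn_ile1 // invf_le1 // ler1n.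
Qed.

End newton_complex.

(** * Approximate idempotents *)

Section spectrum.
Variables (R : realType) (B : comPzRingType) (c : {rmorphism R[i] -> B}).
Variables (X : Type) (ev : X -> B -> R[i]) (evc : forall x, is_char c (ev x)).
Hypothesis ev_surj : forall phi, is_char c phi -> exists x, forall f, phi f = ev x f.
Implicit Types (q : B -> R) (f g h e : B) (x y : X).
Local Notation submult := (submult_seminorm c).

(** This plays the role of the spectrum of the completion of [B] under [q], without constructing the
    completion. *)
Definition sp q : set X := [set x | forall f, normc (ev x f) <= q f].

Lemma sp_mono q q' : (forall f, q' f <= q f) -> sp q' `<=` sp q.
Proof. by move=> qq' x Hx f; apply: le_trans (Hx f) _. Qed.

(** Together with [sp_contraction]: passing to [adj q G] cuts [sp q] down to the points where every
    element of [G] has modulus at most one. *)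
Lemma sp_adj q G x : submult q -> monoid_set G -> sp q x ->
  (forall g, G g -> normc (ev x g) <= 1) -> sp (adj q G) x.
Proof.
move=> sq GM xq xG f; rewrite -[leRHS]mulr1.
exact: (le_adj GM f (char_submult (evc x))).
Qed.

Lemma sp_contraction q G x g : submult q -> sp (adj q G) x -> G g ->
  normc (ev x g) <= 1.
Proof. by move=> sq xq Gg; apply: le_trans (xq g) (adj_contraction sq Gg). Qed.

Lemma adj_mono q G1 G2 f : submult q -> monoid_set G1 -> G1 `<=` G2 ->
  adj q G2 f <= adj q G1 f.
Proof.
move=> sq GM G12; apply: lb_le_inf; first exact: adj_rep_nonempty.
move=> t Ht; apply: (adj_le_rep sq).
by elim: Ht => [|a g f' t' Gg _ IH]; [exact: adj_rep0|apply: adj_repS => //; exact: G12].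
Qed.

Lemma power_bounded_of_sp q h (rho : R) : submult q -> 0 < rho ->
  (forall x, sp q x -> normc (ev x h) < rho) ->
  exists2 C : R, 0 <= C & forall n, q (h ^+ n) <= C * rho ^+ n.
Proof.
move=> sq rho0 hrho; apply: contrapT => /(exists_char sq rho0)[phi [pc pq ph]].
have [x xE] := ev_surj pc.
have xq : sp q x by move=> f; rewrite -xE.
by have := hrho x xq; rewrite -xE ltNge ph.
Qed.

(** The powers of [h / rho] are bounded for [q], so adjoining them as contractions gives an
    equivalent seminorm. Pointwise bounds on the spectrum thus become bounds in a seminorm, as
    Newton's estimates require. *)
Lemma renorm q h (rho : R) : submult q -> 0 < rho ->
  (forall x, sp q x -> normc (ev x h) < rho) ->
  exists q', [/\ submult q', forall f, q' f <= q f,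
    exists2 C : R, 0 <= C & forall f, q f <= C * q' f & q' h <= rho].
Proof.
move=> sq rho0 hrho; have [C C0 hC] := power_bounded_of_sp sq rho0 hrho.
pose u := c (rho^-1)%:C%C * h; have GM := monoid_powers u.
have nrho : normc (rho^-1)%:C%C = rho^-1 by rewrite normc_real gtr0_norm ?invr_gt0.
exists (adj q (powers u)); split.
- exact: adj_submult.
- exact: (adj_le sq GM).
- exists C => // f; rewrite mulrC; apply: (le_adj GM f sq) => // _ [n ->].
  rewrite exprMn -rmorphXn; apply: le_trans (snZ sq _ _) _.
  by rewrite normcX nrho exprVn ler_pdivrMl ?exprn_gt0 // mulrC.
- have -> : h = c rho%:C%C * u.
    rewrite /u mulrA -rmorphM /= -(rmorphM (real_complex R)) mulfV ?gt_eqF //.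
    by rewrite rmorph1 mul1r.
  apply: le_trans (snZ (adj_submult sq GM) _ _) _; rewrite normc_real gtr0_norm //.
  by rewrite ler_piMr ?(ltW rho0) // (adj_contraction sq) //; exists 1%N.
Qed.

Lemma renorm3 q h1 h2 h3 (r1 r2 r3 : R) : submult q -> 0 < r1 -> 0 < r2 -> 0 < r3 ->
  (forall x, sp q x -> [/\ normc (ev x h1) < r1, normc (ev x h2) < r2 & normc (ev x h3) < r3]) ->
  exists q', [/\ submult q',
    exists2 C : R, 0 <= C & forall f, q f <= C * q' f &
    [/\ q' h1 <= r1, q' h2 <= r2 & q' h3 <= r3]].
Proof.
move=> sq r10 r20 r30 H.
have [|q1 [s1 q1q [C1 C10 qq1] q1h]] := renorm (h := h1) sq r10.
  by move=> x /H[].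
have [|q2 [s2 q2q [C2 C20 qq2] q2h]] := renorm (h := h2) s1 r20.
  by move=> x /(sp_mono q1q)/H[].
have [|q3 [s3 q3q [C3 C30 qq3] q3h]] := renorm (h := h3) s2 r30.
  by move=> x /(sp_mono q2q)/(sp_mono q1q)/H[].
exists q3; split=> //.
  exists (C1 * (C2 * C3)); first by rewrite !mulr_ge0.
  move=> f; apply: le_trans (qq1 f) _; rewrite -mulrA ler_wpM2l //.
  by apply: le_trans (qq2 f) _; rewrite -mulrA ler_wpM2l.
split=> //; last by apply: le_trans q2h.
by apply: le_trans (q3q _) (le_trans (q2q _) q1h).
Qed.

Variables E F : set X.

(** The tolerance [1 / 200] keeps both the defect and the difference of two such elements below the
    [1 / 50] of [idem_iter_bounds]. *)
Definition approx_idem q e := forall x, sp q x ->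
  (E x -> normc (ev x e) <= 1 / 200) /\ (F x -> normc (1 - ev x e) <= 1 / 200).

Lemma idem_iter_ev a n x :
  ev x (iter n (@idem_step B) a) = iter n (@idem_step R[i]) (ev x a).
Proof. by elim: n => // n IH /=; rewrite (char_idem_step _ (evc x)) IH. Qed.

Lemma approx_idem_iter q a n : approx_idem q a ->
  forall x, sp q x ->
  (E x -> normc (ev x (iter n (@idem_step B) a)) <= 1 / 200 * 2^-1 ^+ n) /\
  (F x -> normc (1 - ev x (iter n (@idem_step B) a)) <= 1 / 200 * 2^-1 ^+ n).
Proof.
move=> aq x /aq[xE xF]; rewrite idem_iter_ev.
by split=> [/xE|/xF]; [exact: idem_iter_near0|exact: idem_iter_near1].
Qed.

Lemma approx_idem_newton q a : approx_idem q a -> sp q `<=` E `|` F ->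
  forall x, sp q x -> normc (ev x (a - a ^+ 2)) < 1 / 50 /\ normc (ev x (2%:R * a - 1)) < 2.
Proof.
move=> aq cov x xq; have [xE xF] := aq x xq.
have -> : ev x (a - a ^+ 2) = ev x a * (1 - ev x a).
  by rewrite (charB (evc x)) (charX (evc x)); ring.
have -> : ev x (2%:R * a - 1) = ev x a - (1 - ev x a).
  by rewrite (charB (evc x)) (charM (evc x)) (char_nat (evc x)) (char1 (evc x)); ring.
set z := ev x a in xE xF *; rewrite normcM.
have n1 := normc1 R.
have z0 := normc_ge0 z; have w0 := normc_ge0 (1 - z).
have zw : normc (z - (1 - z)) <= normc z + normc (1 - z).
  by apply: le_trans (normcD _ _) _; rewrite normcN.
have w1 : normc (1 - z) <= 1 + normc z.
  by apply: le_trans (normcD _ _) _; rewrite normcN n1.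
have z1 : normc z <= 1 + normc (1 - z).
  have {1}-> : z = 1 - (1 - z) by ring.
  by apply: le_trans (normcD _ _) _; rewrite normcN n1.
have [/xE H|/xF H] := cov x xq.
  have : normc z * normc (1 - z) <= 1 / 200 * 2 by apply: ler_pM => //; lra.
  by split; lra.
have : normc z * normc (1 - z) <= 2 * (1 / 200) by apply: ler_pM => //; lra.
by split; lra.
Qed.

(* The Cousin problem in one variable: the two approximate solutions [a] and [b]
   are close on [|g| = 1]; after sharpening, the difference is a Laurent
   polynomial in [g] with small coefficients, whose two halves are small on
   [|g| <= 1] and on [|g| >= 1] respectively. *)
Lemma approx_idem_merge q g g' a b : submult q -> g * g' = 1 -> sp q `<=` E `|` F ->
  approx_idem (adj q (powers g)) a -> approx_idem (adj q (powers g')) b ->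
  exists e, approx_idem q e.
Proof.
move=> sq gg' cov aq bq.
have GL := monoid_powers g; have GR := monoid_powers g'; have GM := monoid_powersV gg'.
pose Q := adj q (powers g `|` powers g').
have sQ : submult Q by exact: adj_submult.
have QL x : sp Q x -> sp (adj q (powers g)) x.
  by apply: sp_mono => f; apply: adj_mono => //; exact: subsetUl.
have QR x : sp Q x -> sp (adj q (powers g')) x.
  by apply: sp_mono => f; apply: adj_mono => //; exact: subsetUr.
have adjq G x : monoid_set G -> sp (adj q G) x -> sp q x.
  by move=> GG; apply: sp_mono => f; exact: (adj_le sq GG).
have aQ : approx_idem Q a by move=> x /QL; exact: aq.
have bQ : approx_idem Q b by move=> x /QR; exact: bq.
have covQ : sp Q `<=` E `|` F by move=> x /(adjq _ _ GM); exact: cov.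
have [||||q' [sq' [C C0 QC] [q'1 q'2 q'3]]] :=
  @renorm3 Q (a - a ^+ 2) (2%:R * a - 1) (a - b) (1 / 50) 2 (1 / 50) sQ.
- lra.
- lra.
- lra.
- move=> x xQ; have [? ?] := approx_idem_newton aQ covQ xQ; split=> //.
  rewrite (charB (evc x)); have [aE aF] := aQ x xQ; have [bE bF] := bQ x xQ.
  have [xE|xF] := covQ x xQ.
    apply: le_lt_trans (normcD _ _) _; rewrite normcN.
    have := aE xE; have := bE xE; lra.
  have -> : ev x a - ev x b = (1 - ev x b) - (1 - ev x a) by ring.
  apply: le_lt_trans (normcD _ _) _; rewrite normcN.
  have := aF xF; have := bF xF; lra.
(* One Newton step already halves the error [1 / 200]; the correction by half of the difference may
   use the other [1 / 400]. *)
have [n n1 Cn] : exists2 n, (0 < n)%N & C * (1 / 50 * 2^-1 ^+ n) < 1 / 400.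
  have [||n n0 nC] := @exists_half_power R (C / 50) (1 / 400); [lra|lra|].
  by exists n => //; move: nC; rewrite -mulrA; lra.
have [_ _ dn] := idem_iter_bounds sq' q'1 q'2 q'3 n.
set an := iter n _ a in dn; set bn := iter n _ b in dn.
have Qd : Q (an - bn) < 1 / 400.
  apply: le_lt_trans (QC _) _; apply: le_lt_trans Cn.
  by rewrite ler_wpM2l.
have [h1 [h2 [dE h1L h2R]]] := adj_setU sq GM Qd.
have n2 : (2^-1 : R) ^+ n <= 2^-1.
  by rewrite -[leRHS]expr1 ler_wiXn2l // invf_le1 // ler1n.
(* This element equals [bn + h2]: the first form is estimated where [g] has modulus at most one, the
   second elsewhere. *)
exists (an - h1) => x xq.
have [gx|gx] := leP (normc (ev x g)) 1.
  have xL : sp (adj q (powers g)) x.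
    apply: sp_adj => // _ [k ->]; rewrite (charX (evc x)) normcX.
    by rewrite exprn_ile1 // normc_ge0.
  have [xE xF] := approx_idem_iter n aq xL; have hx := xL h1.
  rewrite (charB (evc x)); split.
    move=> /xE H; apply: le_trans (normcD _ _) _; rewrite normcN; move: H; lra.
  move=> /xF H; rewrite opprB addrCA addrC; apply: le_trans (normcD _ _) _; lra.
have xR : sp (adj q (powers g')) x.
  apply: sp_adj => // _ [k ->]; rewrite (charX (evc x)) normcX.
  rewrite exprn_ile1 // ?normc_ge0 //.
  have : normc (ev x g) * normc (ev x g') = 1.
    by rewrite -normcM -(charM (evc x)) gg' (char1 (evc x)) normc1.
  have := normc_ge0 (ev x g'); nra.
have [xE xF] := approx_idem_iter n bq xR; have hx := xR h2.
have -> : an - h1 = bn + h2 by rewrite -[an](subrK bn) dE; ring.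
rewrite (charD (evc x)); split.
  move=> /xE H; apply: le_trans (normcD _ _) _; lra.
move=> /xF H; rewrite opprD addrA; apply: le_trans (normcD _ _) _; rewrite normcN; lra.
Qed.

(** Induction on the list, for all [q] at once. On either side of the cut along the first unit, that
    unit no longer separates points of [E] from points of [F], so the remaining ones do. With none
    left, [sp q] cannot meet both sets and a constant suffices. *)
Lemma exists_approx_idem (gs : seq (B * B)) :
  (forall p, p \in gs -> p.1 * p.2 = 1) ->
  forall q, submult q -> sp q `<=` E `|` F ->
  (forall x y, sp q x -> sp q y -> E x -> F y ->
     exists2 p, p \in gs & normc (ev x p.1) < 1 < normc (ev y p.1)) ->
  exists e, approx_idem q e.
Proof.
elim: gs => [|[g g'] gs IH] inv q sq cov sep.
  have [[y [yq yF]]|nF] := pselect (exists y, sp q y /\ F y).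
    exists 1 => x xq; rewrite (char1 (evc x)) subrr normc0; split=> // xE.
    by have [] := sep x y xq yq xE yF.
  exists 0 => x xq; rewrite -(rmorph0 c) (charC (evc x)) normc0; split=> // xF.
  by exfalso; apply: nF; exists x.
have gg' : g * g' = 1 by apply: (inv (g, g')); exact: mem_head.
have invs p : p \in gs -> p.1 * p.2 = 1 by move=> pgs; apply: inv; rewrite inE pgs orbT.
have GL := monoid_powers g; have GR := monoid_powers g'.
have Hq G x : monoid_set G -> sp (adj q G) x -> sp q x.
  by move=> GG; apply: sp_mono => f; exact: (adj_le sq GG).
have [|||a aq] := IH invs (adj q (powers g)).
- exact: adj_submult.
- by move=> x /(Hq _ _ GL)/cov.
- move=> x y xq yq xE yF.
  have [p] := sep x y (Hq _ _ GL xq) (Hq _ _ GL yq) xE yF.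
  rewrite inE => /orP[/eqP->|pgs] /= /andP[xp yp]; last by exists p => //; rewrite xp.
  have : normc (ev y g) <= 1 by apply: (sp_contraction sq yq); exists 1%N.
  by rewrite leNgt yp.
have [|||b bq] := IH invs (adj q (powers g')).
- exact: adj_submult.
- by move=> x /(Hq _ _ GR)/cov.
- move=> x y xq yq xE yF.
  have [p] := sep x y (Hq _ _ GR xq) (Hq _ _ GR yq) xE yF.
  rewrite inE => /orP[/eqP->|pgs] /= /andP[xp yp]; last by exists p => //; rewrite xp.
  have : normc (ev x g') <= 1 by apply: (sp_contraction sq xq); exists 1%N.
  have : normc (ev x g) * normc (ev x g') = 1.
    by rewrite -normcM -(charM (evc x)) gg' (char1 (evc x)) normc1.
  have := normc_ge0 (ev x g); have := normc_ge0 (ev x g'); nra.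
exact: approx_idem_merge sq gg' cov aq bq.
Qed.

End spectrum.

(** * The Shilov idempotent theorem *)

Section operator_norm.
Variables (R : realType) (B : comPzRingType) (c : {rmorphism R[i] -> B}).
Variables (N : B -> R) (N_ge0 : forall f, 0 <= N f)
  (ND : forall f g, N (f + g) <= N f + N g)
  (NZ : forall a f, N (c a * f) <= normc a * N f)
  (NM : forall f g, N (f * g) <= N f * N g).
Implicit Types (f g h : B).

(** The norm of multiplication by [f]. It is equivalent to [N], which may exceed one at the unit,
    whereas a [submult_seminorm] may not. *)
Definition opnorm f := inf [set t : R | 0 <= t /\ forall g, N (f * g) <= t * N g].

Let bounds f : set R := [set t : R | 0 <= t /\ forall g, N (f * g) <= t * N g].

Let bounds_nonempty f : bounds f !=set0.
Proof. by exists (N f); split=> [|g]; [exact: N_ge0|exact: NM]. Qed.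

Let bounds_ge0 f t : bounds f t -> 0 <= t. Proof. by case. Qed.

Let opnorm_le f t : bounds f t -> opnorm f <= t.
Proof. exact: (le_inf_elt (@bounds_ge0 f)). Qed.

Lemma opnorm_le_norm f : opnorm f <= N f.
Proof. by apply: opnorm_le; split=> [|g]; [exact: N_ge0|exact: NM]. Qed.

Lemma opnormM f g : N (f * g) <= opnorm f * N g.
Proof. by apply: le_inf_mulr => [||t [t0]]; [exact: bounds_nonempty|exact: N_ge0|exact]. Qed.

Lemma norm_le_opnorm f : N f <= opnorm f * N 1.
Proof. by rewrite -{1}[f]mulr1; exact: opnormM. Qed.

Lemma opnorm_submult : submult_seminorm c opnorm.
Proof.
have bn := bounds_nonempty; have bg := bounds_ge0.
split=> [f|f g|a f|f g|].
- by apply: lb_le_inf; [exact: bn|move=> t /bg].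
- apply: le_inf_add; [exact: bn|exact: bn|move=> t u [t0 ft] [u0 gu]].
  apply: opnorm_le; split=> [|k]; first exact: addr_ge0.
  by rewrite !mulrDl; apply: le_trans (ND _ _) _; exact: lerD.
- rewrite [leRHS]mulrC; apply: le_inf_mulr; [exact: bn|exact: normc_ge0|move=> t [t0 ft]].
  apply: opnorm_le; split=> [|k]; first by rewrite mulr_ge0 ?normc_ge0.
  rewrite -mulrA; apply: le_trans (NZ _ _) _; rewrite mulrC mulrAC.
  by rewrite ler_wpM2r ?normc_ge0.
- apply: le_inf_mul; [exact: bn|exact: bn|by move=> t /bg|by move=> t /bg|].
  move=> t u [t0 ft] [u0 gu]; apply: opnorm_le; split=> [|k]; first exact: mulr_ge0.
  rewrite -!mulrA; apply: le_trans (ft _) _.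
  by rewrite ler_wpM2l.
- by apply: opnorm_le; split=> // g; rewrite !mul1r.
Qed.

End operator_norm.

Section quotient_seminorm.
Variables (R : realType) (B : comPzRingType) (c : {rmorphism R[i] -> B}).
Variables (q : B -> R) (sq : submult_seminorm c q).
Variables (I : set B) (I0 : I 0) (ID : forall f g, I f -> I g -> I (f + g))
  (IM : forall f g, I g -> I (f * g)).
Implicit Types (f g h : B).

Let E f : set R := [set q (f - g) | g in I].

(** The quotient norm modulo [I], pulled back so that no quotient algebra has to be formed. *)
Definition quot_seminorm f := inf [set q (f - g) | g in I].

Let E0 f : E f !=set0. Proof. by exists (q (f - 0)), 0. Qed.

Let Ege0 f t : E f t -> 0 <= t. Proof. by move=> [g _ <-]; exact: (sn_ge0 sq). Qed.

Let quot_le f g : I g -> quot_seminorm f <= q (f - g).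
Proof. by move=> Ig; apply: (le_inf_elt (@Ege0 f)); exists g. Qed.

Lemma quot_seminorm_le f : quot_seminorm f <= q f.
Proof. by have := quot_le f I0; rewrite subr0. Qed.

Lemma quot_seminorm_lt f (e : R) : quot_seminorm f < e -> exists2 g, I g & q (f - g) < e.
Proof. by move=> /(inf_lt (E0 f))[_ [g Ig <-]] fe; exists g. Qed.

Lemma le_quot_seminorm f (t : R) : (forall g, I g -> t <= q (f - g)) -> t <= quot_seminorm f.
Proof. by move=> H; apply: lb_le_inf; [exact: E0|move=> _ [g Ig <-]; exact: H]. Qed.

Lemma quot_seminorm_submult : submult_seminorm c quot_seminorm.
Proof.
split=> [f|f g|a f|f g|].
- by apply: lb_le_inf; [exact: E0|move=> t /Ege0].
- apply: le_inf_add; [exact: E0|exact: E0|move=> _ _ [i Ii <-] [j Ij <-]].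
  apply: le_trans (quot_le _ (ID Ii Ij)) _.
  by rewrite opprD addrACA; exact: (snD sq).
- rewrite [leRHS]mulrC; apply: le_inf_mulr; [exact: E0|exact: normc_ge0|move=> _ [i Ii <-]].
  apply: le_trans (quot_le _ (IM (c a) Ii)) _.
  by rewrite -mulrBr [leRHS]mulrC; exact: (snZ sq).
- apply: le_inf_mul; [exact: E0|exact: E0|by move=> t /Ege0|by move=> t /Ege0|].
  move=> _ _ [i Ii <-] [j Ij <-].
  have Ik : I (f * j + (g - j) * i) by apply: ID; exact: IM.
  apply: le_trans (quot_le _ Ik) _.
  have -> : f * g - (f * j + (g - j) * i) = (f - i) * (g - j) by ring.
  exact: (snM sq).
- exact: le_trans (quot_seminorm_le 1) (sn1 sq).
Qed.

End quotient_seminorm.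

Lemma continuous_normc (R : realType) (T : topologicalType) (f : T -> Cplx R) :
  continuous f -> continuous (fun x => normc (f x)).
Proof.
move=> cf x; apply/cvgrPdist_lt => e e0.
have /cvgrPdist_lt/(_ e%:C%C) := cf x.
rewrite ltcR => /(_ e0); apply: filterS => y.
rewrite -[`|_ - _|]/((normc (f x - f y))%:C%C) ltcR => H.
rewrite ltr_norml; have := normcB (f x) (f y); have := normcB (f y) (f x).
by rewrite -[normc (f y - f x)]normcN opprB; move: H; lra.
Qed.

(** * Evaluations on a function algebra *)

Section function_algebra.
Variables (R : realType) (X : topologicalType) (A : functionAlgebra R X).
Implicit Types (f g h : elt A) (x y : X).

Lemma elt_eqP f g : (forall x, f x = g x) -> f = g.
Proof. by move=> fg; apply: val_inj; apply/funext. Qed.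

Definition cst_elt (a : R[i]) : elt A := exist _ (cst a) (mem_set (fa_cst A a)).

Lemma cst_elt_zmod : zmod_morphism cst_elt.
Proof. by move=> a b; apply: elt_eqP. Qed.

Lemma cst_elt_monoid : monoid_morphism cst_elt.
Proof. by split=> [|a b]; apply: elt_eqP. Qed.

HB.instance Definition _ := GRing.isZmodMorphism.Build R[i] (elt A) cst_elt cst_elt_zmod.
HB.instance Definition _ := GRing.isMonoidMorphism.Build R[i] (elt A) cst_elt cst_elt_monoid.

Definition eval (x : X) (f : elt A) : R[i] := f x.

Lemma eval_char x : is_char cst_elt (eval x).
Proof. by split. Qed.

Lemma scale_cst_elt a f : a *: f = cst_elt a * f.
Proof. exact: elt_eqP. Qed.

Lemma is_char_character (phi : elt A -> R[i]) :
  is_char cst_elt phi -> is_character (phi : elt A -> Cplx R).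
Proof.
move=> pc; split.
- by exists 1; rewrite (char1 pc); exact/eqP/oner_neq0.
- by move=> a f g; rewrite scale_cst_elt (charD pc) (charM pc) (charC pc).
- exact: (charM pc).
Qed.

Lemma eval_surj : natural A ->
  forall phi, is_char cst_elt phi -> exists x, forall f, phi f = eval x f.
Proof.
move=> nat phi /is_char_character pc.
pose psi : charSpace A := exist
  (fun p => p \in [set p : {ptws elt A -> Cplx R} | is_character p]) phi (mem_set pc).
have [x xE] := nat psi.
by exists x => f; rewrite -[RHS]xE.
Qed.

Lemma continuous_eval f : continuous (f : X -> Cplx R).
Proof. exact: fa_continuous (set_mem (svalP f)). Qed.

Lemma open_normc_lt f (r : R) : open [set x | normc (f x) < r].
Proof.
by apply: (@open_comp _ _ (fun x => normc (f x)) [set t | t < r]);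
  [move=> x _; exact/continuous_normc/continuous_eval|exact: open_lt].
Qed.

Lemma open_normc_gt f (r : R) : open [set x | r < normc (f x)].
Proof.
by apply: (@open_comp _ _ (fun x => normc (f x)) [set t | t > r]);
  [move=> x _; exact/continuous_normc/continuous_eval|exact: open_gt].
Qed.

End function_algebra.

Arguments eval {R X A} x f.
Arguments eval_char {R X A} x.

(** * Completeness, Neumann series and separating units *)

Section banach_function_algebra.
Variables (R : realType) (X : topologicalType) (A : functionAlgebra R X).
Variables (N : elt A -> R) (NB : is_banach_algebra_norm N).
Implicit Types (f g h : elt A) (x y : X).
Local Notation c := (@cst_elt R X A).

Lemma banach_normZ a f : N (c a * f) = normc a * N f.
Proof. by rewrite -scale_cst_elt (norm_scale NB). Qed.

Lemma banach_norm0 : N 0 = 0.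
Proof. by have := banach_normZ 0 0; rewrite mulr0 normc0 mul0r. Qed.

Lemma banach_normN f : N (- f) = N f.
Proof.
by have := banach_normZ (- 1) f; rewrite rmorphN1 mulN1r normcN normc1 mul1r.
Qed.

Lemma banach_norm_ge0 f : 0 <= N f.
Proof.
have := norm_add NB f (- f); rewrite subrr banach_norm0 banach_normN; lra.
Qed.

Lemma banach_opnorm_submult : submult_seminorm c (opnorm N).
Proof.
apply: opnorm_submult.
- exact: banach_norm_ge0.
- exact: (norm_add NB).
- by move=> a f; rewrite banach_normZ.
- exact: (norm_mul NB).
Qed.

Lemma banach_opnorm_ge0 f : 0 <= opnorm N f.
Proof. exact: (sn_ge0 banach_opnorm_submult). Qed.

Lemma banach_norm_le_opnorm f : N f <= opnorm N f * N 1.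
Proof. exact: (norm_le_opnorm banach_norm_ge0 (norm_mul NB)). Qed.

Lemma banach_geometric_limit (u : nat -> elt A) (C : R) : 0 <= C ->
  (forall n, N (u n.+1 - u n) <= C * 2^-1 ^+ n) ->
  exists f, forall e : R, 0 < e -> exists m, forall n, (m <= n)%N -> N (u n - f) < e.
Proof.
move=> C0 uC.
(* The factor [1 - 2^-1 ^+ k] makes the induction on [k] close. *)
have tail n k : N (u (n + k)%N - u n) <= C * 2 * 2^-1 ^+ n * (1 - 2^-1 ^+ k).
  elim: k => [|k IH]; first by rewrite addn0 subrr banach_norm0 expr0 subrr mulr0.
  have -> : u (n + k.+1)%N - u n = (u (n + k).+1 - u (n + k)%N) + (u (n + k)%N - u n).
    by rewrite addnS addrA subrK.
  apply: le_trans (norm_add NB _ _) _; apply: le_trans (lerD (uC _) IH) _.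
  rewrite exprD exprS; set s := 2^-1 ^+ n; set t := 2^-1 ^+ k; lra.
have tail2 n k : (n <= k)%N -> N (u k - u n) <= C * 2 * 2^-1 ^+ n.
  move=> nk; rewrite -(subnKC nk); apply: le_trans (tail _ _) _.
  rewrite ler_piMr ?mulr_ge0 // ?exprn_ge0 // lerBlDr lerDl exprn_ge0 //.
have [e e0|f uf] := norm_complete NB (u := u).
  have [n _ nC] := @exists_half_power R (C * 2) (e / 2)
    ltac:(by rewrite mulr_ge0) ltac:(by rewrite divr_gt0).
  exists n => i j ni nj.
  have -> : u i - u j = (u i - u n) - (u j - u n) by rewrite opprB addrA subrK.
  apply: le_lt_trans (norm_add NB _ _) _; rewrite banach_normN.
  have := tail2 _ _ ni; have := tail2 _ _ nj; lra.
exists f => e e0; have /cvgrPdist_lt/(_ e e0)[m _ Hm] := uf.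
exists m => n /Hm /=; rewrite sub0r normrN ger0_norm //; exact: banach_norm_ge0.
Qed.

Lemma banach_eq0 f : (forall e : R, 0 < e -> N f < e) -> f = 0.
Proof.
move=> fe; apply: (norm_eq0 NB); apply/le_anti; rewrite banach_norm_ge0 andbT.
by apply/ler_addgt0Pr => e e0; rewrite add0r ltW // fe.
Qed.

Lemma neumann f : N f <= 2^-1 -> exists g, (1 - f) * g = 1.
Proof.
move=> f2; pose u n := \sum_(k < n) f ^+ k.
have N1 := banach_norm_ge0 1.
have fn n : N (f ^+ n) <= N 1 * 2^-1 ^+ n.
  elim: n => [|n IH]; first by rewrite !expr0 mulr1.
  rewrite exprSr; apply: le_trans (norm_mul NB _ _) _.
  by rewrite exprSr mulrA; apply: ler_pM => //; exact: banach_norm_ge0.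
have [|g ug] := @banach_geometric_limit u (N 1) N1.
  by move=> n; rewrite /u big_ord_recr /= addrAC subrr add0r.
have uE n : (1 - f) * u n = 1 - f ^+ n.
  elim: n => [|n IH]; first by rewrite /u big_ord0 mulr0 expr0 subrr.
  by rewrite /u big_ord_recr /= mulrDr IH exprS; ring.
exists g; apply/eqP; rewrite -subr_eq0; apply/eqP/banach_eq0 => e e0.
have K0 : 0 < N (1 - f) + 1 by rewrite ltr_wpDl // banach_norm_ge0.
have [m Hm] := ug (e / 2 / (N (1 - f) + 1)) ltac:(by rewrite !divr_gt0).
have [n _ nC] := @exists_half_power R (N 1) (e / 2) N1 ltac:(by rewrite divr_gt0).
pose k := maxn m n.
have -> : (1 - f) * g - 1 = - ((1 - f) * (u k - g)) - f ^+ k.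
  have -> : f ^+ k = 1 - (1 - f) * u k by rewrite uE subKr.
  ring.
apply: le_lt_trans (norm_add NB _ _) _; rewrite !banach_normN.
have H1 : N (f ^+ k) < e / 2.
  apply: le_lt_trans (fn _) (le_lt_trans _ nC).
  by rewrite ler_wpM2l // ler_wiXn2l ?leq_maxr // invf_le1 // ler1n.
have H2 : N ((1 - f) * (u k - g)) <= e / 2.
  apply: le_trans (norm_mul NB _ _) _.
  have := Hm k (leq_maxl _ _); rewrite ltr_pdivlMr // => H.
  have := banach_norm_ge0 (u k - g); have := banach_norm_ge0 (1 - f); lra.
lra.
Qed.

(** Automatic continuity of evaluations: otherwise some power [g] of [f / f x] is so small that
    [1 - g] is invertible by [neumann], although it vanishes at [x]. *)
Lemma eval_le_opnorm x f : normc (f x) <= opnorm N f.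
Proof.
rewrite leNgt; apply/negP => fx; have f0 := banach_opnorm_ge0 f.
have fx0 : 0 < normc (f x) by exact: le_lt_trans fx.
pose r := opnorm N f / normc (f x); have N1 := banach_norm_ge0 1.
have r0 : 0 <= r by rewrite divr_ge0 // ltW.
have [n rn] : exists n, N 1 * r ^+ n <= 2^-1.
  apply: contrapT => nr; have : 1 <= r.
    apply: (@ge1_of_powers _ (2 * N 1)) => // n.
    rewrite -mulrA -ler_pdivrMl // mulr1 leNgt; apply/negP => H.
    by apply: nr; exists n; exact: ltW.
  by rewrite ler_pdivlMr // mul1r leNgt fx.
have fn0 : f x != 0 by apply: contraTneq fx0 => ->; rewrite normc0 ltxx.
pose g : elt A := c (f x ^- n) * f ^+ n.
have gx : eval x g = 1.
  rewrite (charM (eval_char x)) (charC (eval_char x)).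
  by rewrite (charX (eval_char x)) mulVf // expf_neq0.
have [k gk] : exists k, (1 - g) * k = 1.
  apply: neumann; rewrite banach_normZ normcV normcX.
  apply: le_trans rn; rewrite mulrC ler_pdivrMr ?exprn_gt0 //.
  have -> : N 1 * r ^+ n * normc (f x) ^+ n = opnorm N f ^+ n * N 1.
    by rewrite /r expr_div_n mulrA divfK ?expf_neq0 ?gt_eqF // mulrC.
  apply: le_trans (banach_norm_le_opnorm _) _.
  by rewrite ler_wpM2r // (snX banach_opnorm_submult).
have := congr1 (eval x) gk.
rewrite (charM (eval_char x)) (charB (eval_char x)) (char1 (eval_char x)).
by rewrite gx subrr mul0r => /esym/eqP; rewrite oner_eq0.
Qed.

(** Take [h] equal to [0] at [x] and [1] at [y]. For large [K] the element [h + K] is a unit, with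
    values [K] and [K + 1]; dividing by [r], midway between them, puts one value on each side of
    modulus one. *)
Lemma separating_unit x y : x <> y ->
  exists g g' : elt A, g * g' = 1 /\ normc (eval x g) < 1 < normc (eval y g).
Proof.
move=> /(fa_separates A)[f0 f0A f0xy].
pose f : elt A := exist _ f0 (mem_set f0A).
have fxy : f y - f x != 0 by rewrite subr_eq0; apply/eqP => /esym.
pose h : elt A := c (f y - f x)^-1 * (f - c (f x)).
have hx : eval x h = 0.
  rewrite (charM (eval_char x)) (charB (eval_char x)).
  by rewrite !(charC (eval_char x)) /eval subrr mulr0.
have hy : eval y h = 1.
  rewrite (charM (eval_char y)) (charB (eval_char y)).
  by rewrite !(charC (eval_char y)) /eval mulVf.
have Nh := banach_norm_ge0 h.
pose K : R := 2 * N h + 1; have K0 : 0 < K by rewrite /K; lra.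
pose r : R := K + 2^-1; have r0 : 0 < r by rewrite /r; lra.
have Kn : (K%:C%C : R[i]) != 0 by rewrite eq_complex /= gt_eqF.
have rn : (r%:C%C : R[i]) != 0 by rewrite eq_complex /= gt_eqF.
have [k hk] : exists k, (1 - (- (c (K%:C%C)^-1 * h))) * k = 1.
  apply: neumann; rewrite banach_normN banach_normZ normcV normc_real gtr0_norm //.
  by rewrite ler_pdivrMl // /K; lra.
exists (c (r%:C%C)^-1 * (h + c K%:C%C)), (c (r%:C%C * (K%:C%C)^-1) * k).
have gE z : eval z (c (r%:C%C)^-1 * (h + c K%:C%C)) = (r%:C%C)^-1 * (eval z h + K%:C%C).
  rewrite (charM (eval_char z)) (charD (eval_char z)).
  by rewrite !(charC (eval_char z)).
split.
  rewrite -{}[RHS]hk rmorphM.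
  have -> : c (r%:C%C)^-1 * (h + c K%:C%C) * (c r%:C%C * c (K%:C%C)^-1 * k) =
     (c (r%:C%C)^-1 * c r%:C%C) * ((c (K%:C%C)^-1 * c K%:C%C) + c (K%:C%C)^-1 * h) * k by ring.
  by rewrite -!rmorphM !mulVf // rmorph1 mul1r opprK.
rewrite !gE hx hy add0r !normcM normcV !normc_real.
have -> : (1 + K%:C%C : R[i]) = (1 + K)%:C%C by apply/eqP; rewrite eq_complex /= addr0 !eqxx.
rewrite normc_real !gtr0_norm //; last exact: addr_gt0.
by apply/andP; split; [rewrite ltr_pdivrMl // mulr1|rewrite ltr_pdivlMl // mulr1];
  rewrite /r; lra.
Qed.

End banach_function_algebra.

(** A finite subcover obtained from near-coverings, using the filter of index sequences that contain
    a given sequence. *)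
Lemma compact_seq_cover (T : topologicalType) (J : eqType) (K : set T)
    (D : set J) (W : J -> set T) :
  compact K -> (forall j, D j -> open (W j)) ->
  (forall x, K x -> exists2 j, D j & W j x) ->
  exists2 s : seq J, (forall j, j \in s -> D j) &
    forall x, K x -> exists2 j, j \in s & W j x.
Proof.
move=> /compact_near_coveringP cK Wo KW.
pose F : set_system (seq J) :=
  filter_from setT (fun s : seq J => [set t : seq J | {subset s <= t}]).
have FF : Filter F.
  apply: filter_from_filter; first by exists [::].
  move=> s t _ _; exists (s ++ t) => // u stu.
  by split=> j js; apply: stu; rewrite mem_cat js ?orbT.
pose P (t : seq J) x := exists2 j, j \in t & D j /\ W j x.
have [x Kx|s _ sP] := cK _ F P FF.
  have [j Dj Wx] := KW x Kx.
  exists (W j, [set t : seq J | {subset [:: j] <= t}]).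
    by split; [apply: open_nbhs_nbhs; split=> //; exact: Wo|exists [:: j]].
  move=> [y t] [/= Wy jt]; exists j; first by apply: jt; exact: mem_head.
  by split.
exists [seq j <- s | j \in D] => [j|x Kx].
  by rewrite mem_filter => /andP[/set_mem].
have [j js [Dj Wx]] := sP s (fun _ => id) x Kx.
by exists j => //; rewrite mem_filter mem_set.
Qed.

(** * Idempotents modulo an ideal *)

Section shilov.
Variables (R : realType) (X : topologicalType) (A : functionAlgebra R X).
Variables (N : elt A -> R) (NB : is_banach_algebra_norm N) (A_natural : natural A).
Implicit Types (f g h : elt A) (x y : X).
Local Notation c := (@cst_elt R X A).
Variables (I : set (elt A)) (I0 : I 0) (ID : forall f g, I f -> I g -> I (f + g))
  (IM : forall f g, I g -> I (f * g)).

Let q := quot_seminorm (opnorm N) I.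
Let hullI := [set x | forall f, I f -> eval x f = 0].

Let sN := banach_opnorm_submult NB.

Let sq : submult_seminorm c q.
Proof. exact: (@quot_seminorm_submult R (elt A) c (opnorm N) sN I I0 ID IM). Qed.

Lemma sp_quot_seminorm : sp eval q = hullI.
Proof.
apply/seteqP; split=> x xH f.
  move=> If; apply: eq0_normc; apply/le_anti; rewrite normc_ge0 andbT.
  apply: le_trans (xH f) _; rewrite -(sn0 sN) -(subrr f).
  apply: (le_inf_elt (E := [set opnorm N (f - g) | g in I])); last by exists f.
  by move=> _ [g _ <-]; exact: (sn_ge0 sN).
apply: (le_quot_seminorm I0) => g Ig; apply: le_trans (eval_le_opnorm NB x (f - g)).
by rewrite -[elt_fun _ x]/(eval x (f - g)) (charB (eval_char x)) (xH g Ig) subr0.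
Qed.

(* Newton's iteration converges modulo [I]; subtracting elements of [I] makes it
   converge in [A] without changing the values on the hull. *)
Lemma approx_idem_lift (E F : set X) a : approx_idem eval E F q a ->
  hullI `<=` E `|` F ->
  exists z : elt A, forall x, hullI x -> (E x -> eval x z = 0) /\ (F x -> eval x z = 1).
Proof.
rewrite -sp_quot_seminorm => aq cov.
(* Only one Newton sequence is followed here, so the slot for the difference of two receives
   [a - a]. *)
have [||||q' [sq' [C C0 qC] [q'1 q'2 q'3]]] :=
  @renorm3 _ _ c _ _ (eval_surj A_natural) q (a - a ^+ 2) (2%:R * a - 1) (a - a)
    (1 / 50) 2 (1 / 50) sq.
- lra.
- lra.
- lra.
- move=> x xq; have [? ?] := approx_idem_newton eval_char aq cov xq; split=> //.
  by rewrite subrr -(rmorph0 c) (charC (eval_char x)) normc0; lra.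
pose an n := iter n (@idem_step (elt A)) a.
(* The successive differences are bounded by [C * 3 / 50] times [2^-1 ^+ n]; the added [1] makes the
   bound strict, so that an element of [I] can be chosen. *)
pose K : R := C * 3 / 50 + 1.
have K0 : 0 < K by rewrite /K; lra.
have qan n : q (an n.+1 - an n) < K * 2^-1 ^+ n.
  have -> : an n.+1 - an n = (an n - an n ^+ 2) * (2%:R * an n - 1).
    by rewrite /an /= /idem_step; ring.
  have [b1 b2 _] := idem_iter_bounds sq' q'1 q'2 q'3 n.
  have e0 : 0 < (2^-1 : R) ^+ n by rewrite exprn_gt0.
  apply: le_lt_trans (qC _) _.
  have H : q' ((an n - an n ^+ 2) * (2%:R * an n - 1)) <= 1 / 50 * 2^-1 ^+ n * 3.
    apply: le_trans (snM sq' _ _) _; apply: ler_pM; rewrite ?(sn_ge0 sq') //.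
    by apply: le_trans b2 _; lra.
  apply: le_lt_trans (ler_wpM2l C0 H) _; rewrite /K; lra.
have [i iP] := @choice nat (elt A)
  (fun n g => I g /\ opnorm N (an n.+1 - an n - g) < K * 2^-1 ^+ n)
  (fun n => let: ex_intro2 g Ig gn := quot_seminorm_lt I0 (qan n) in
     ex_intro _ g (conj Ig gn)).
pose z n := an n - \sum_(k < n) i k.
have zx n x : sp eval q x -> eval x (z n) = eval x (an n).
  rewrite sp_quot_seminorm => xI; rewrite /z (charB (eval_char x)).
  suff -> : eval x (\sum_(k < n) i k) = 0 by rewrite subr0.
  apply: xI; elim: n => [|n IH]; first by rewrite big_ord0.
  by rewrite big_ord_recr /=; apply: ID => //; exact: (iP n).1.
have N1 := banach_norm_ge0 NB 1.
have [|n|w zw] := @banach_geometric_limit _ _ _ _ NB z (K * N 1).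
- by rewrite mulr_ge0 // ltW.
- have -> : z n.+1 - z n = an n.+1 - an n - i n.
    by rewrite /z big_ord_recr /=; ring.
  apply: le_trans (banach_norm_le_opnorm NB _) _; rewrite mulrAC.
  by rewrite ler_wpM2r // ltW // (iP n).2.
have eq_lim x (t : R[i]) : sp eval q x ->
    (forall n, normc (t - eval x (an n)) <= 1 / 200 * 2^-1 ^+ n) -> eval x w = t.
  move=> xq tn; apply/eqP; rewrite -subr_eq0; apply/eqP/eq0_normc/le_anti.
  rewrite normc_ge0 andbT; apply/ler_addgt0Pr => e e0; rewrite add0r.
  have e2 : 0 < e / 2 by rewrite divr_gt0.
  have [m Hm] := zw _ e2.
  have [k _ kP] := @exists_half_power R (1 / 200) (e / 2) ltac:(lra) e2.
  pose n := maxn m k.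
  have H1 : normc (t - eval x (an n)) < e / 2.
    apply: le_lt_trans (tn n) (le_lt_trans _ kP).
    by rewrite ler_wpM2l ?ler_wiXn2l ?leq_maxr // ?invf_le1 ?ler1n //; lra.
  have H2 : normc (eval x (z n - w)) < e / 2.
    apply: le_lt_trans (eval_le_opnorm NB x _) (le_lt_trans _ (Hm n (leq_maxl _ _))).
    by apply: (opnorm_le_norm (banach_norm_ge0 NB)); exact: (norm_mul NB).
  have -> : eval x w - t = - (eval x (z n - w)) - (t - eval x (an n)).
    by rewrite (charB (eval_char x)) zx //; ring.
  apply: le_trans (normcD _ _) _; rewrite !normcN; lra.
exists w => x xI; split=> [xE|xF]; apply: eq_lim => // n.
  by rewrite sub0r normcN; have [+ _] := approx_idem_iter eval_char n aq xI; exact.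
by have [_ +] := approx_idem_iter eval_char n aq xI; exact.
Qed.

(** Compactness of [E] times [F] reduces the units separating single pairs of points to a finite
    list. *)
Theorem shilov_idempotent (E F : set X) : compact [set: X] ->
  closed E -> closed F -> E `&` F = set0 -> hullI `<=` E `|` F ->
  exists z : elt A, forall x, hullI x -> (E x -> eval x z = 0) /\ (F x -> eval x z = 1).
Proof.
move=> cX cE cF EF cov.
have cEF : compact (E `*` F).
  by apply: compact_setX; [apply: (subclosed_compact cE cX)|apply: (subclosed_compact cF cX)].
pose D : set (elt A * elt A) := [set p | p.1 * p.2 = 1].
pose W (p : elt A * elt A) : set (X * X) :=
  [set xy | normc (eval xy.1 p.1) < 1] `&` [set xy | 1 < normc (eval xy.2 p.1)].
have [||gs gsD gsW] := @compact_seq_cover _ _ _ D W cEF.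
- move=> p _; apply: openI.
    apply: (@open_comp _ _ fst [set x | normc (eval x p.1) < 1]).
      by move=> xy _; exact: cvg_fst.
    exact: open_normc_lt.
  apply: (@open_comp _ _ snd [set x | 1 < normc (eval x p.1)]).
    by move=> xy _; exact: cvg_snd.
  exact: open_normc_gt.
- move=> [x y] [/= xE yF]; have xy : x <> y.
    move=> xy; have : (E `&` F) x by split=> //; rewrite xy.
    by rewrite EF.
  have [g [g' [gg' /andP[gx gy]]]] := separating_unit NB xy.
  by exists (g, g').
have [p||x y _ _ xE yF|a aq] :=
  @exists_approx_idem _ _ c _ _ eval_char (eval_surj A_natural) E F gs _ q sq.
- by move=> pg; exact: gsD.
- by rewrite sp_quot_seminorm.
- have [p pg [/= gx gy]] := gsW (x, y) (conj xE yF).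
  by exists p => //; rewrite gx gy.
exact: approx_idem_lift aq cov.
Qed.

End shilov.

(** * Connectedness of hulls *)

Section connected_hull.
Variables (R : realType) (X : topologicalType) (A : functionAlgebra R X).
Variables (N : elt A -> R) (NB : is_banach_algebra_norm N) (A_natural : natural A).
Hypotheses (cX : compact [set: X]) (hX : hausdorff_space X).
Implicit Types (f g h : elt A) (x y : X) (U V : set X).

Definition kernel_of U : set (elt A) := [set h | forall u, U u -> eval u h = 0].

Lemma kernel_of0 U : kernel_of U 0.
Proof. by []. Qed.

Lemma kernel_ofD U f g : kernel_of U f -> kernel_of U g -> kernel_of U (f + g).
Proof. by move=> Uf Ug u Uu; rewrite (charD (eval_char u)) Uf // Ug // addr0. Qed.

Lemma kernel_ofM U f g : kernel_of U g -> kernel_of U (f * g).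
Proof. by move=> Ug u Uu; rewrite (charM (eval_char u)) Ug // mulr0. Qed.

Variables (x0 : X) (UU : set (set X)).
Hypotheses (UU0 : UU !=set0) (UUx0 : forall U, UU U -> U x0).
Hypothesis UUI : forall U V, UU U -> UU V -> exists2 W, UU W & W `<=` U `&` V.
Hypothesis UUe : forall U (e : elt A), UU U -> eval x0 e = 0 ->
  (forall y, U y -> eval y e = 0 \/ eval y e = 1) ->
  exists2 W, UU W & W `<=` [set y | eval y e = 0].

Definition family_hull := [set y | forall U h, UU U -> kernel_of U h -> eval y h = 0].

Lemma family_hull_x0 : family_hull x0.
Proof. by move=> U h /UUx0 Ux0; exact. Qed.

Lemma closed_eval_eq0 h : closed [set y : X | eval y h = 0].
Proof.
have -> : [set y | eval y h = 0] = ~` [set y | 0 < normc (eval y h)].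
  apply/seteqP; split=> y /=; first by move=> ->; rewrite normc0 ltxx.
  move=> /negP; rewrite -leNgt => H; apply: eq0_normc; apply/le_anti.
  by rewrite H normc_ge0.
exact/open_closedC/open_normc_gt.
Qed.

Lemma closed_family_hull : closed family_hull.
Proof.
have -> : family_hull = \bigcap_(h in [set h | exists2 U, UU U & kernel_of U h])
    [set y | eval y h = 0].
  apply/seteqP; split=> y yH.
    by move=> h [U UUU Uh]; exact: yH Uh.
  by move=> U h UUU Uh; apply: yH; exists U.
by apply: closed_bigI => h _; exact: closed_eval_eq0.
Qed.

Lemma family_hull_split (E F : set X) : closed E -> closed F -> E `&` F = set0 ->
  family_hull = E `|` F -> E x0 -> F = set0.
Proof.
move=> cE cF EF HEF Ex0.
have [P EP PF] : exists2 P, set_nbhs E P & closure P `<=` ~` F.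
  have FE : set_nbhs E (~` F).
    apply/set_nbhsP; exists (~` F); split=> //; first exact: closed_openC.
    by move=> y Ey Fy; rewrite -[False]/(set0 y) -EF.
  by have [P EP PF] := compact_normal hX cX cE FE; exists P.
have EPo : E `<=` P° by move=> y Ey; exact: EP.
(* [T] is [closure P] without its interior part. It misses the family hull, so compactness and
   directedness of [UU] yield a single [U] whose hull misses [T]. *)
pose T := ~` (P° `|` ~` closure P).
have cT : compact T.
  apply: (subclosed_compact _ cX) => //; apply: open_closedC; apply: openU.
    exact: open_interior.
  exact/closed_openC/closed_closure.
have [h _|y Ty|s sJ sT] := @compact_seq_cover X (elt A) T
    [set h | exists2 U, UU U & kernel_of U h] (fun h => [set y | 0 < normc (eval y h)]) cT.
- exact: open_normc_gt.
- have nHy : ~ family_hull y.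
    rewrite HEF => -[Ey|Fy]; apply: Ty; [by left; exact: EPo|by right=> /PF].
  apply: contrapT => nh; apply: nHy => U h UUU Uh; apply: contrapT => yh.
  apply: nh; exists h; first by exists U.
  by rewrite /= lt_neqAle normc_ge0 andbT eq_sym; apply/eqP => /eq0_normc.
have [U UUU Us] : exists2 U, UU U & forall h, h \in s -> kernel_of U h.
  elim: s sJ {sT} => [_|h s IH sJ]; first by have [U UUU] := UU0; exists U.
  have [|U UUU Us] := IH.
    by move=> k ks; apply: sJ; rewrite inE ks orbT.
  have [V UUV Vh] : exists2 V, UU V & kernel_of V h by apply: sJ; exact: mem_head.
  have [W UUW WUV] := UUI UUU UUV; exists W => // k.
  rewrite inE => /orP[/eqP -> u /WUV[_ Vu]|/Us Uk u /WUV[Uu _]]; first exact: Vh.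
  exact: Uk.
pose hullU := [set y : X | forall f, kernel_of U f -> eval y f = 0].
have hullUP : hullU `<=` P° `|` ~` closure P.
  move=> y yU; apply: contrapT => /sT[h hs].
  by rewrite /= (yU h (Us h hs)) normc0 ltxx.
have hullUE y : hullU y -> closure P y -> P° y.
  by move=> /hullUP[].
have cH : closed hullU.
  have -> : hullU = \bigcap_(h in kernel_of U) [set y | eval y h = 0] by [].
  by apply: closed_bigI => h _; exact: closed_eval_eq0.
have [|||| e eH] := shilov_idempotent NB A_natural (@kernel_of0 U) (@kernel_ofD U)
    (@kernel_ofM U) (E := hullU `&` closure P) (F := hullU `&` ~` P°) cX.
- by apply: closedI => //; exact: closed_closure.
- by apply: closedI => //; apply: open_closedC; exact: open_interior.
- by apply/seteqP; split=> // y [[yU /(hullUE _ yU) Py] [_]].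
- move=> y yU; have [Py|nPy] := pselect (P° y).
    by left; split=> //; apply: subset_closure; exact: interior_subset.
  by right.
have UhullU y : U y -> hullU y by move=> Uy f; exact.
have e01 y : hullU y -> (closure P y /\ eval y e = 0) \/ (~ closure P y /\ eval y e = 1).
  move=> yU; have [e0 e1] := eH y yU.
  have [Py|nPy] := pselect (closure P y); first by left; split=> //; exact: e0.
  right; split=> //; apply: e1; split=> // Py; apply: nPy.
  by apply: subset_closure; exact: interior_subset.
have x0P : closure P x0 by apply: subset_closure; apply: interior_subset; exact: EPo.
have ex0 : eval x0 e = 0 by case: (e01 x0 (UhullU _ (UUx0 UUU))) => -[].
have [|W UUW We] := UUe UUU ex0.
  by move=> y /UhullU/e01[[_ ->]|[_ ->]]; [left|right].
(* Since [e] vanishes on the member [W] of the family, it vanishes at [y]; but [y] lies outside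
   [closure P], where [e] is [1]. *)
apply/seteqP; split=> // y Fy.
have yH : family_hull y by rewrite HEF; right.
have yU : hullU y by move=> f; exact: yH.
have ey0 : eval y e = 0 by exact: (yH W).
case: (e01 y yU) => [[Py _]|[_]]; first by have := PF _ Py.
by rewrite ey0 => /esym/eqP; rewrite oner_eq0.
Qed.

Lemma connected_family_hull : connected family_hull.
Proof.
move=> B [b Bb] [C oC BC] [D cD BD].
have cH := closed_family_hull.
pose B' := family_hull `&` ~` C.
have cB : closed B by rewrite BD; exact: closedI.
have cB' : closed B' by apply: closedI => //; exact: open_closedC.
have BB' : B `&` B' = set0.
  by rewrite BC; apply/seteqP; split=> // y [[_ Cy] [_]].
have HB : family_hull = B `|` B'.
  rewrite BC -setIUr setUv setIT //.
(* Whichever of the two closed pieces contains [x0], the other is empty. *)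
have [Bx0|nBx0] := pselect (B x0).
  by have B'0 := family_hull_split cB cB' BB' HB Bx0; rewrite HB B'0 setU0.
have B'x0 : B' x0 by have := family_hull_x0; rewrite {1}HB => -[].
have B0 := family_hull_split cB' cB (etrans (setIC _ _) BB') (etrans HB (setUC _ _)) B'x0.
by have : B b := Bb; rewrite B0.
Qed.

End connected_hull.

(** * Point evaluations and the Gelfand topology *)

Section char_space.
Variables (R : realType) (X : topologicalType) (A : functionAlgebra R X).
Implicit Types (f g h : elt A) (x y : X).

Lemma eval_character x : is_character (eval x : elt A -> Cplx R).
Proof. exact: is_char_character (eval_char x). Qed.

Definition point_eval x : charSpace A := exist
  (fun p => p \in [set p : {ptws elt A -> Cplx R} | is_character p])
  (eval x) (mem_set (eval_character x)).

Lemma continuous_point_eval : continuous point_eval.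
Proof.
move=> x.
have H : {ptws, (fun y => eval y : elt A -> Cplx R) @ x --> (eval x : elt A -> Cplx R)}.
  apply/cvg_sup => f V [_ [[W oW <-] Wx WV]].
  apply: filterS WV _.
  exact: (continuous_eval (f := f) (open_nbhs_nbhs (conj oW Wx))).
move=> U [_ [[B oB <-] Bx BU]].
apply: filterS BU _; apply: (H B); exact: open_nbhs_nbhs.
Qed.

Lemma gelfand_continuous f : continuous (@gelfand R X A f).
Proof.
move=> phi.
apply: (@continuous_comp _ _ _ (set_val : charSpace A -> {ptws elt A -> Cplx R})
  (@proj _ (fun _ => Cplx R) f)).
  exact: initial_continuous.
exact: proj_continuous.
Qed.

Lemma gelfand_point_eval f x : gelfand f (point_eval x) = eval x f.
Proof. by []. Qed.

Lemma point_eval_surj : natural A -> forall phi, exists x, phi = point_eval x.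
Proof.
move=> nat phi; have [x xE] := nat phi; exists x.
by apply: val_inj; apply/funext => f; exact: xE.
Qed.

End char_space.

(** * Annihilators and hull-kernel separation *)

Section annihilators.
Variables (R : realType) (X : topologicalType) (A : functionAlgebra R X).
Variables (N : elt A -> R) (NB : is_banach_algebra_norm N).
Implicit Types (f g h : elt A) (S : set (elt A)).

Definition annihilator S : set (elt A) := [set f | forall g, S g -> f * g = 0].

Lemma annihilator_closed_ideal S : is_closed_ideal N (annihilator S).
Proof.
split.
- by move=> g _; rewrite mul0r.
- by move=> f g Sf Sg h Sh; rewrite mulrDl Sf // Sg // addr0.
- by move=> f g Sg h Sh; rewrite -mulrA Sg // mulr0.
move=> f fS g Sg; apply: (banach_eq0 NB) => e e0.
have g0 := banach_norm_ge0 NB g.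
have [h hS fh] := fS (e / (N g + 1)) ltac:(by rewrite divr_gt0 // ltr_wpDl).
have -> : f * g = (f - h) * g by rewrite mulrBl hS // subr0.
apply: le_lt_trans (norm_mul NB _ _) _.
move: fh; rewrite ltr_pdivlMr ?ltr_wpDl // => fh.
have := banach_norm_ge0 NB (f - h); nra.
Qed.

Lemma hk_inseparableP (x y : X) :
  hk_inseparable N (point_eval A x) (point_eval A y) <->
  forall f g : elt A, eval x f != 0 -> (forall z, eval z f != 0 -> eval z g = 0) ->
    eval y g = 0.
Proof.
split=> [xy f g fx fg|H [U [V [[I1 _ ->] [I2 _ ->] xU yV UV]]]].
  apply: contrapT => gy; apply: xy.
  (* Here [f] lies in [I1] because [f * g = 0], and [g] lies in [I2]. Products of [I1] and [I2]
     vanish, which makes the two open sets disjoint. *)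
  pose I1 := annihilator [set g]; pose I2 := annihilator I1.
  exists [set z | ~ (I1 `<=` Mideal z)], [set z | ~ (I2 `<=` Mideal z)]; split.
  - by exists I1 => //; exact: annihilator_closed_ideal.
  - by exists I2 => //; exact: annihilator_closed_ideal.
  - move=> /(_ f) /= xf; move/eqP: fx; apply; apply: xf => h /= ->.
    apply: elt_eqP => z; rewrite -[LHS]/(eval z (f * g)) (charM (eval_char z)).
    have [->|fz] := eqVneq (eval z f) 0; first by rewrite mul0r.
    by rewrite fg // mulr0.
  - move=> /(_ g) /= yg; apply: gy; apply: yg => h hI1.
    by rewrite mulrC; exact: hI1.
  apply/seteqP; split=> // z [/= z1 z2].
  have [k kI1 kz] : exists2 k, I1 k & gelfand k z != 0.
    apply: contrapT => nk; apply: z1 => k kI1; apply: contrapT => kz.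
    by apply: nk; exists k => //; exact/eqP.
  apply: z2 => l lI2; have zc : is_character (val z) := set_mem (valP z).
  have : gelfand (l * k) z = gelfand l z * gelfand k z by exact: (character_mul zc).
  rewrite lI2 //.
  have -> : gelfand 0 z = 0.
    have := character_mul zc 0 0.
    have := character_lin zc 1 0 0.
    rewrite scaler0 addr0 mul1r -{1}[val z 0]addr0 => /addrI; rewrite /gelfand => <-.
    by [].
  by move=> /esym/eqP; rewrite mulf_eq0 (negPf kz) orbF => /eqP.
have [f fI1 fx] : exists2 f, I1 f & eval x f != 0.
  apply: contrapT => nk; apply: xU => k kI1; apply: contrapT => kx.
  by apply: nk; exists k => //; exact/eqP.
have [g gI2 gy] : exists2 g, I2 g & eval y g != 0.
  apply: contrapT => nk; apply: yV => k kI1; apply: contrapT => kx.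
  by apply: nk; exists k => //; exact/eqP.
move/eqP: gy; apply; apply: (H f) => // z fz; apply: contrapT => gz.
have : set0 (point_eval A z).
  rewrite -UV; split=> /= [/(_ f fI1)|/(_ g gI2)] //; exact/eqP.
by [].
Qed.

End annihilators.

Theorem theorem3p2 (R : realType) (X : topologicalType)
    (X_compact : compact [set: X]) (X_hausdorff : hausdorff_space X)
    (A : functionAlgebra R X) (N : elt A -> R)
    (A_banach : is_banach_algebra_norm N) (A_natural : natural A)
    (x : charSpace A) :
  connected (hull (Jideal x)) /\
  connected [set y : charSpace A | hk_inseparable N x y].
Proof.
have [x0 ->] := point_eval_surj A_natural x.
have conn := connected_family_hull A_banach A_natural X_compact X_hausdorff.
split.
- pose UU := [set U : set X | exists2 V, nbhs (point_eval A x0) V &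
    U = @point_eval R X A @^-1` V].
  have -> : hull (Jideal (point_eval A x0)) = @point_eval R X A @` family_hull A UU.
    apply/seteqP; split=> [phi phiH|_ [y yH <-] h].
      have [y yE] := point_eval_surj A_natural phi; exists y; last by rewrite yE.
      move=> _ h [V Vx ->] Vh.
      rewrite -gelfand_point_eval -yE; apply: phiH.
      apply: filterS Vx => psi Vpsi; have [z zE] := point_eval_surj A_natural psi.
      by rewrite zE gelfand_point_eval; apply: Vh; rewrite /= -zE.
    move=> hx; apply: (yH (@point_eval R X A @^-1` [set psi | gelfand h psi = 0])) => //.
    by exists [set psi | gelfand h psi = 0].
  apply: connected_continuous_connected; last first.
    exact/continuous_subspaceT/continuous_point_eval.
  apply: (conn x0).
  + by exists setT; exists setT; [exact: filterT|].
  + by move=> _ [V Vx ->]; exact: (nbhs_singleton Vx).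
  + move=> _ _ [V Vx ->] [W Wx ->]; exists (@point_eval R X A @^-1` (V `&` W)) => //.
    by exists (V `&` W) => //; exact: filterI.
  + move=> _ e [V Vx ->] ex0 e01.
    (* As [e] takes only the values [0] and [1] on [V], modulus below one means that it vanishes. *)
    pose W := V `&` [set psi | normc (gelfand e psi) < 1].
    exists (@point_eval R X A @^-1` W).
      exists W => //; apply: filterI => //.
      apply: open_nbhs_nbhs; split; last by rewrite /= gelfand_point_eval ex0 normc0.
      apply: (@open_comp _ _ (fun psi => normc (gelfand e psi)) [set t | t < 1]).
        by move=> psi _; exact/continuous_normc/gelfand_continuous.
      exact: open_lt.
    move=> y [Vy]; rewrite /= gelfand_point_eval.
    by have [->//|->] := e01 y Vy; rewrite normc1 ltxx.
- pose UU := [set U : set X | exists2 f : elt A, eval x0 f != 0 &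
    U = [set y | eval y f != 0]].
  have -> : [set y : charSpace A | hk_inseparable N (point_eval A x0) y] =
      @point_eval R X A @` family_hull A UU.
    apply/seteqP; split=> [phi|_ [y yH <-]].
      have [y ->] := point_eval_surj A_natural phi => /(hk_inseparableP A_banach) H.
      by exists y => // _ h [f fx ->] fh; exact: (H f).
    apply/(hk_inseparableP A_banach) => f g fx fg.
    by apply: (yH [set y | eval y f != 0]) => //; exists f.
  apply: connected_continuous_connected; last first.
    exact/continuous_subspaceT/continuous_point_eval.
  apply: (conn x0).
  + exists [set y | eval y (1 : elt A) != 0], 1 => //.
    by rewrite (char1 (eval_char x0)) oner_neq0.
  + by move=> _ [f fx ->].
  + move=> _ _ [f fx ->] [g gx ->]; exists [set y | eval y (f * g) != 0].
      by exists (f * g) => //; rewrite (charM (eval_char x0)) mulf_neq0.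
    by move=> y /=; rewrite (charM (eval_char y)) mulf_eq0 negb_or => /andP.
  (* Multiplying [f] by [1 - e] removes from its cozero set exactly the points where [e] is [1], and
     keeps [x0]. *)
  + move=> _ e [f fx ->] ex0 e01; exists [set y | eval y (f * (1 - e)) != 0].
      exists (f * (1 - e)) => //; rewrite (charM (eval_char x0)) (charB (eval_char x0)).
      by rewrite ex0 (char1 (eval_char x0)) subr0 mulr1.
    move=> y /=; rewrite (charM (eval_char y)) (charB (eval_char y)) (char1 (eval_char y)).
    rewrite mulf_eq0 negb_or => /andP[fy].
    by have [->//|->] := e01 y fy; rewrite subrr eqxx.
Qed.
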